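(* Let $W=(W_i)_{i\in[d]}$ and $Z=(Z_i)_{i\in[d]}$ be two Gaussian random vectors with $\mathbf{E}(W_i)=\mathbf{E}(Z_i)$ for every $i\in[d]$, and let $\gamma=\max_{(i,j)\in[d]^2}\bigl|\mathbf{E}((W_i-W_j)^2)-\mathbf{E}((Z_i-Z_j)^2)\bigr|$. Then, for any $h\in[d]$, $$\bigl|\mathbf{E}(W_{(h)})-\mathbf{E}(Z_{(h)})\bigr|\le\sqrt{\gamma}\Bigl(\sqrt{2\log\binom dh}+\sqrt{\log h}\Bigr)\le\sqrt{\gamma}\Bigl(\sqrt{2h(1+\log(d/h))}+\sqrt{\log h}\Bigr).$$
   Context: $[d]=\{1,\dots,d\}$. For $z\in\mathbb{R}^d$, $z_{(1)}\le z_{(2)}\le\dots\le z_{(d)}$ denote the order statistics of its components in increasing order, so $z_{(h)}$ is the $h$-th smallest component. *)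

(* Defs.v *)
From mathcomp Require Import all_boot all_order all_algebra.
From mathcomp Require Import all_classical all_reals all_analysis.

Set Implicit Arguments.
Unset Strict Implicit.
Unset Printing Implicit Defensive.

Import Order.TTheory GRing.Theory Num.Theory.

Local Open Scope classical_set_scope.
Local Open Scope ring_scope.

(* The law N(m, s^2) on the line. The case s = 0 is set apart because
   [normal_prob m 0] is the uniform law on [0, 1] and not the point mass. *)
Definition gaussian_law (R : realType) (m s : R) : set R -> \bar R :=
  if s == 0 then \d_m else normal_prob m s.

(* Every linear combination of the components is Gaussian; degenerate laws are
   allowed, so the covariance matrix may be singular. *)
Definition gaussian_vector (R : realType) (dT : measure_display)
    (T : measurableType dT) (P : probability T R) (d : nat)
    (W : 'I_d -> {RV P >-> R}) : Prop :=
  forall a : 'I_d -> R, exists m s : R, 0 <= s /\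
    forall B : set R, measurable B ->
      P ((fun w => \sum_(i < d) a i * W i w) @^-1` B) = gaussian_law m s B.

(* z_(h), where h is counted from 1; meaningful for 1 <= h <= d. *)
Definition order_stat (R : realType) (d : nat) (z : 'I_d -> R) (h : nat) : R :=
  nth 0 (sort <=%R [seq z i | i <- enum 'I_d]) h.-1.

(* [fine] is harmless on Gaussian vectors, whose second moments are finite;
   the default 0 of the maximum is harmless because its terms are
   nonnegative. *)
Definition increment_gap (R : realType)
    (dT : measure_display) (T : measurableType dT) (P : probability T R)
    (dU : measure_display) (U : measurableType dU) (Q : probability U R)
    (d : nat) (W : 'I_d -> {RV P >-> R}) (Z : 'I_d -> {RV Q >-> R}) : R :=
  \big[Num.max/0]_(ij : 'I_d * 'I_d)
    `| fine 'E_P[fun w => ((W ij.1 w - W ij.2 w) ^+ 2)%R]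
       - fine 'E_Q[fun u => ((Z ij.1 u - Z ij.2 u) ^+ 2)%R] |.

(* Main.v *)
Require Import Defs.
From mathcomp Require Import all_boot all_order all_algebra.
From mathcomp Require Import all_classical all_reals all_analysis.
From mathcomp Require Import measurable_realfun.
From mathcomp Require Import ring lra.

(** The order statistic z_(h) is the minimum, over the subsets S of h indices,
    of the maximum of z over S. Replacing the maximum by a log-sum-exp at inverse
    temperature b and the minimum by one at inverse temperature -a gives a smooth
    function F with
      z_(h) - (ln C(d,h)) / a <= F(z) <= z_(h) + (ln h) / b
    ([soft_order_stat_ge], [soft_order_stat_le]). Gaussian interpolation then
    compares E F(W) and E F(Z): along X_t = m + sqrt t (W - m) + sqrt(1-t) (Z - m),
    with W and Z independent, the derivative of E F(X_t) is E (L F)(X_t), where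
    L = 1/2 sum A_ij d_i d_j and A is the difference of the two covariance
    matrices. Both layers of F are shift-equivariant, so L F is a combination of
    variances of the quadratic form A under probability weights. These only see
    the increments A_ii + A_jj - 2 A_ij, which are bounded by gamma; this yields
    |L F| <= gamma (b/4 + a/2). Optimising in a and b gives the bound.

    The vectors are Gaussian only in the sense that their linear combinations
    are, so the interpolation formula is first available for the functions
    cos(c.x + k), whose expectations are explicit ([gaussian_cos]), and for their
    span, the trigonometric polynomials ([trig_interp_derive]). To reach F it is
    composed with x_i |-> l sin(x_i / l), which is itself a trigonometric
    polynomial, takes values in a compact cube, and tends to the identity as l
    grows. On the cube, exp and ln are limits of polynomials together with their
    first two derivatives, and trigonometric polynomials form an algebra; hence
    the composite is a limit of trigonometric polynomials p, uniformly on the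
    whole space, with p, its gradient and L p all converging ([soft_jet]). This
    is expressed with jets (value, gradient, L-value), which form an algebra
    under the Leibniz rule, so that no calculus in several variables is needed.
    As l grows the errors are of order 1/l times moments of W and Z
    ([order_stat_gap_temperatures]).

    The formula for E cos is a one-dimensional fact: Stein's identity
    ([normal_stein]) turns v |-> E cos(k + v (X - m)) into the solution of a
    linear differential equation; it gives the mean and the variance as well.
    The second inequality is C(d,h) <= d^h / h! <= (e d / h)^h. *)
Set Implicit Arguments.
Unset Strict Implicit.
Unset Printing Implicit Defensive.

Import Order.TTheory GRing.Theory Num.Theory.
Import numFieldNormedType.Exports.

Local Open Scope classical_set_scope.
Local Open Scope ring_scope.

(** * Integration by parts against a normal density *)

Section gauss1.
Context {R : realType}.
Implicit Types (m s x v : R).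
Notation mu := (@lebesgue_measure R).

Lemma der_mul (f g : R -> R) x (a b : R) :
  is_derive x 1 f a -> is_derive x 1 g b ->
  is_derive x 1 (fun y => f y * g y) (a * g x + f x * b).
Proof.
move=> df dg; have := is_deriveM df dg.
move/(is_derive_eq); apply; rewrite /GRing.scale/=; ring.
Qed.

Lemma der_add (f g : R -> R) x (a b : R) :
  is_derive x 1 f a -> is_derive x 1 g b ->
  is_derive x 1 (fun y => f y + g y) (a + b).
Proof. exact: is_deriveD. Qed.

Lemma der_ext (f g : R -> R) x (a b : R) :
  is_derive x 1 f a -> (forall y, g y = f y) -> b = a -> is_derive x 1 g b.
Proof. by move=> df /funext -> ->. Qed.

Lemma normal_pdf_is_derive m s x : s != 0 ->
  is_derive x 1 (normal_pdf m s) (- ((x - m) / s ^+ 2) * normal_pdf m s x).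
Proof.
move=> s0; rewrite (normal_pdfE _ s0) /normal_fun.
set k := normal_peak s.
have h2 : is_derive x 1 (fun y : R => - (y - m) ^+ 2 / (s ^+ 2 *+ 2))
    (- ((x - m) / s ^+ 2)).
  have d1 : is_derive x 1 (fun y : R => y - m) 1.
    by apply: is_derive_eq; rewrite subr0.
  have d2 := der_mul (der_mul d1 d1) (is_derive_cst (- (s ^+ 2 *+ 2)^-1) x 1).
  apply: (der_ext d2) => [y|]; first by rewrite /=; ring.
  by rewrite /= -mulr_natr; field.
have := is_derive1_comp (@is_derive_expR R _) h2 => h3.
have h4 := der_mul (is_derive_cst k x 1) h3.
by apply: (der_ext h4) => [//|]; rewrite /=; ring.
Qed.

(** A quadratic weight is absorbed by doubling the variance, because
    (1 + u) exp(-u/(4 s^2)) is bounded. This gives at once the integrability of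
    functions of quadratic growth and the decay at infinity. *)
Lemma quad_normal_pdf_le m s x : 0 < s ->
  (1 + (x - m) ^+ 2) * normal_pdf m s x <=
  (1 + 4 * s ^+ 2) * Num.sqrt 2 * normal_pdf m (Num.sqrt 2 * s) x.
Proof.
move=> s0; have s20 : 0 < Num.sqrt 2 * s by rewrite mulr_gt0 ?sqrtr_gt0.
rewrite !normal_pdfE ?gt_eqF//.
have sq : (Num.sqrt 2 * s) ^+ 2 = 2 * s ^+ 2 by rewrite exprMn sqr_sqrtr.
have pk : normal_peak s = Num.sqrt 2 * normal_peak (Num.sqrt 2 * s).
  have -> : normal_peak (Num.sqrt 2 * s) = (Num.sqrt (2 * (s ^+ 2 * pi *+ 2)))^-1.
    by rewrite /normal_peak sq; congr (Num.sqrt _)^-1; ring.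
  by rewrite sqrtrM// invfM mulrA mulfV ?mul1r// gt_eqF// sqrtr_gt0.
rewrite pk; set p := normal_peak _.
set u := (x - m) ^+ 2.
have u0 : 0 <= u by exact: sqr_ge0.
have p0 : 0 <= p by exact: normal_peak_ge0.
have s2 : 0 < s ^+ 2 by rewrite exprn_gt0.
have s2n : s != 0 by rewrite gt_eqF.
rewrite /normal_fun sq -/u.
set w := u / (4 * s ^+ 2).
have e1 : - u / (s ^+ 2 *+ 2) = - w - w by rewrite /w -mulr_natr; field.
have e2 : - u / (2 * s ^+ 2 *+ 2) = - w by rewrite /w -mulr_natr; field.
rewrite e1 e2 expRD.
have w0 : 0 <= w by rewrite /w divr_ge0// mulr_ge0// ltW.
have uw : u = 4 * s ^+ 2 * w by rewrite /w; field.
have key : (1 + u) * expR (- w) <= 1 + 4 * s ^+ 2.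
  rewrite expRN -ler_pdivlMr ?invr_gt0 ?expR_gt0// invrK.
  have h : 1 + w <= expR w := expR_ge1Dx w.
  apply: (@le_trans _ _ ((1 + 4 * s ^+ 2) * (1 + w))).
    rewrite uw; nra.
  by rewrite ler_wpM2l// addr_ge0// mulr_ge0// ltW.
have -> : (1 + u) * (Num.sqrt 2 * p * (expR (- w) * expR (- w))) =
  ((1 + u) * expR (- w)) * (Num.sqrt 2 * (p * expR (- w))) by ring.
rewrite -[leRHS]mulrA ler_wpM2r// mulr_ge0// ?sqrtr_ge0// mulr_ge0// expR_ge0.
Qed.

Lemma integrable_normal_quad m s (h : R -> R) C : 0 < s ->
  measurable_fun setT h -> (forall x, `|h x| <= C * (1 + (x - m) ^+ 2)) ->
  mu.-integrable setT (fun x => (h x * normal_pdf m s x)%:E).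
Proof.
move=> s0 mh hC.
pose K := `|C| * ((1 + 4 * s ^+ 2) * Num.sqrt 2).
apply: (@le_integrable _ _ _ mu _ measurableT _
  (fun x => K%:E * (normal_pdf m (Num.sqrt 2 * s) x)%:E)%E).
- apply/measurable_EFinP/measurable_funM => //; exact: measurable_normal_pdf.
- move=> x _; rewrite -EFinM !abse_EFin lee_fin.
  rewrite [`|h x * _|]normrM [`|normal_pdf m s x|]ger0_norm ?normal_pdf_ge0//.
  apply: (@le_trans _ _ (`|C| * ((1 + (x - m) ^+ 2) * normal_pdf m s x))).
    rewrite mulrA ler_wpM2r ?normal_pdf_ge0//.
    apply: (le_trans (hC x)); rewrite ler_wpM2r// ?ler_norm//.
    by rewrite addr_ge0// sqr_ge0.
  rewrite /K -mulrA normrM normr_id.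
  rewrite ler_wpM2l//.
  apply: le_trans (ler_norm _).
  exact: quad_normal_pdf_le.
- apply: integrableZl => //; exact: integrable_normal_pdf.
Qed.


(** Dominated convergence along growing intervals, which passes the fundamental
    theorem of calculus to the whole line. *)
Lemma cvg_integral_centered m (f : R -> R) :
  mu.-integrable setT (EFin \o f) ->
  \int[mu]_(x in `[m - n.+1%:R, m + n.+1%:R]) f x @[n --> \oo] -->
  \int[mu]_x f x.
Proof.
move=> fi; pose B n := `[m - n.+1%:R, m + n.+1%:R]%classic.
have mB n : measurable (B n : set R) by exact: measurable_itv.
have mf : measurable_fun setT f by move/measurable_int : fi => /measurable_EFinP.
have [] := @dominated_convergence _ _ _ mu setT measurableT
  (fun n => EFin \o (f \_ (B n))) (EFin \o f) (fun x => `|(f x)%:E|)%E.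
- move=> n; apply/measurable_EFinP.
  apply/(measurable_restrictT _ (mB n)); exact: measurable_funS mf.
- exact/measurable_EFinP.
- apply: aeW => x _; apply: cvg_near_cst.
  near=> n; rewrite /= patchE mem_set// /B /= in_itv /=.
  have : `|x - m| <= n%:R by near: n; exact: nbhs_infty_ger.
  rewrite ler_norml -natr1; lra.
- exact: integrable_abse.
- apply: aeW => x n _; rewrite /= lee_fin patchE; case: ifPn => // _.
  by rewrite normr0.
move=> _ _ h; rewrite /Rintegral.
apply: fine_cvg; rewrite -/(B _) fineK; last exact: integrable_fin_num.
have -> : (fun n => \int[mu]_(x in B n) (f x)%:E)%E =
  [sequence (\int[mu]_x (EFin \o f \_ (B n)) x)%E]_n.
  apply/funext => n; rewrite /= integral_mkcond; apply: eq_integral => x _.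
  by rewrite /= restrict_EFin.
exact: h.
Unshelve. all: by end_near. Qed.

(** The function (G' - (x - m)/s^2 G) times the density is the derivative of G
    times the density, which vanishes at infinity. *)
Lemma normal_stein m s (G G' : R -> R) C : 0 < s ->
  (forall x, is_derive x 1 G (G' x)) -> continuous G' ->
  (forall x, `|G x| <= C * (1 + (x - m) ^+ 2)) ->
  (forall x, `|G' x| <= C * (1 + (x - m) ^+ 2)) ->
  (forall x, `|(x - m) * G x| <= C * (1 + (x - m) ^+ 2)) ->
  \int[mu]_x (G' x * normal_pdf m s x) =
  (s ^+ 2)^-1 * \int[mu]_x ((x - m) * G x * normal_pdf m s x).
Proof.
move=> s0 dG cG' bG bG' bxG.
have sn0 : s != 0 by rewrite gt_eqF.
pose f x := G' x * normal_pdf m s x - (s ^+ 2)^-1 * ((x - m) * G x * normal_pdf m s x).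
have dH x : is_derive x 1 (fun y => G y * normal_pdf m s y) (f x).
  have := der_mul (dG x) (normal_pdf_is_derive m x sn0).
  move=> h; apply: (der_ext h) => //; rewrite /f; ring.
have cG : continuous G.
  move=> x; apply/differentiable_continuous/derivable1_diffP.
  exact: (@ex_derive _ _ _ _ _ _ _ (dG x)).
have cx : continuous (fun x : R => x - m).
  by move=> x; apply: cvgB => //; exact: cvg_cst.
have cf : continuous f.
  move=> x; apply: cvgB; first by apply: cvgM; [exact: cG'|exact: continuous_normal_pdf].
  apply: cvgM; first exact: cvg_cst.
  apply: cvgM; last exact: continuous_normal_pdf.
  by apply: cvgM; [exact: cx|exact: cG].
have i1 : mu.-integrable setT (fun x => (G' x * normal_pdf m s x)%:E).
  apply: (@integrable_normal_quad _ _ _ C) => //.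
  exact: continuous_measurable_fun.
have i2 : mu.-integrable setT (fun x => ((x - m) * G x * normal_pdf m s x)%:E).
  apply: (@integrable_normal_quad _ _ (fun x => (x - m) * G x) C) => //.
  by apply: measurable_funM; apply: continuous_measurable_fun.
have i2' : mu.-integrable setT
    (fun x => ((s ^+ 2)^-1 * ((x - m) * G x * normal_pdf m s x))%:E).
  by under eq_fun do rewrite EFinM; exact: integrableZl.
have ifi : mu.-integrable setT (EFin \o f).
  rewrite (_ : EFin \o f = (fun x => (G' x * normal_pdf m s x)%:E -
     ((s ^+ 2)^-1 * ((x - m) * G x * normal_pdf m s x))%:E)%E)//.
  exact: integrableB.
suff If0 : \int[mu]_x f x = 0.
  apply/eqP; rewrite -subr_eq0 -RintegralZl// -RintegralB//.
  exact/eqP.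
have lim := cvg_integral_centered m ifi.
pose K := `|C| * ((1 + 4 * s ^+ 2) * Num.sqrt 2).
pose s' := Num.sqrt 2 * s.
have s'0 : 0 < s' by rewrite mulr_gt0 // sqrtr_gt0.
pose K' := K * ((1 + 4 * s' ^+ 2) * Num.sqrt 2 * normal_peak (Num.sqrt 2 * s')).
have K0 : 0 <= K.
  by rewrite mulr_ge0// mulr_ge0// ?sqrtr_ge0// addr_ge0// mulr_ge0// sqr_ge0.
have bH x : `|G x * normal_pdf m s x| <= K' / (1 + (x - m) ^+ 2).
  have q0 : 0 < 1 + (x - m) ^+ 2 by rewrite ltr_pwDl// sqr_ge0.
  rewrite normrM [`|normal_pdf m s x|]ger0_norm ?normal_pdf_ge0//.
  apply: (@le_trans _ _ (`|C| * ((1 + (x - m) ^+ 2) * normal_pdf m s x))).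
    rewrite mulrA ler_wpM2r ?normal_pdf_ge0//.
    apply: (le_trans (bG x)); rewrite ler_wpM2r// ?ler_norm//.
    exact: ltW.
  apply: (@le_trans _ _ (K * normal_pdf m s' x)).
    rewrite /K -mulrA ler_wpM2l//; exact: quad_normal_pdf_le.
  rewrite /K' -mulrA ler_wpM2l// ler_pdivlMr// mulrC.
  apply: (le_trans (quad_normal_pdf_le m x s'0)).
  rewrite ler_wpM2l//.
    by rewrite mulr_ge0// ?sqrtr_ge0// addr_ge0// mulr_ge0// sqr_ge0.
  apply: normal_pdf_ub; rewrite gt_eqF// mulr_gt0// sqrtr_gt0//.
have K'0 : 0 <= K'.
  have := bH m; rewrite subrr expr0n addr0 divr1; exact: le_trans.
have In n : `|\int[mu]_(x in `[m - n.+1%:R, m + n.+1%:R]) f x| <= 2 * K' * n.+1%:R^-1.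
  have ab : m - n.+1%:R < m + n.+1%:R.
    by rewrite ltrBlDr -addrA ltrDl addr_gt0.
  have -> : \int[mu]_(x in `[m - n.+1%:R, m + n.+1%:R]) f x =
    G (m + n.+1%:R) * normal_pdf m s (m + n.+1%:R) -
    G (m - n.+1%:R) * normal_pdf m s (m - n.+1%:R).
    rewrite /Rintegral (@continuous_FTC2 _ f (fun y => G y * normal_pdf m s y))//.
    - exact: continuous_subspaceT.
    - split.
      + by move=> x _; exact: (@ex_derive _ _ _ _ _ _ _ (dH x)).
      + apply: cvg_at_right_filter; apply: cvgM; [exact: cG|exact: continuous_normal_pdf].
      + apply: cvg_at_left_filter; apply: cvgM; [exact: cG|exact: continuous_normal_pdf].
    - by move=> x _; rewrite derive1E (@derive_val _ _ _ _ _ _ _ (dH x)).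
  have le1 : K' / (1 + n.+1%:R ^+ 2) <= K' * n.+1%:R^-1.
    rewrite ler_wpM2l// lef_pV2 ?posrE// ?ltr_pwDl ?sqr_ge0//.
    have := sqr_ge0 (n.+1%:R - 1 : R); nra.
  apply: (le_trans (ler_normB _ _)).
  have := bH (m + n.+1%:R); have := bH (m - n.+1%:R).
  have -> : m + n.+1%:R - m = n.+1%:R by ring.
  have -> : m - n.+1%:R - m = - n.+1%:R by ring.
  rewrite sqrrN => h1 h2; apply: (le_trans (lerD h2 h1)).
  by rewrite -mulrA mulr_natl mulr2n lerD.
have l0 : (fun n => 2 * K' * n.+1%:R^-1) @ \oo --> (0 : R).
  rewrite -[X in _ --> X](mulr0 (2 * K')); apply: cvgM; first exact: cvg_cst.
  exact: cvg_harmonic.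
have l1 : \int[mu]_(x in `[m - n.+1%:R, m + n.+1%:R]) f x @[n --> \oo] --> (0 : R).
  apply: norm_cvg0; apply: (@squeeze_cvgr _ _ _ _ (cst 0) _ _ _ _ _ l0).
    by apply: nearW => n; rewrite /= normr_ge0 In.
  exact: cvg_cst.
exact: (cvg_unique _ lim l1).
Qed.

End gauss1.

(** * Expectations under a Gaussian law *)

Section gauss2.
Context {R : realType}.
Notation mu := (@lebesgue_measure R).

(** The density is the Radon-Nikodym derivative almost everywhere, both having
    the same integral over every set. *)
Lemma ge0_integral_normal_prob (m s : R) (f : R -> \bar R) :
  (forall x, 0 <= f x)%E -> measurable_fun setT f ->
  (\int[normal_prob m s]_x f x = \int[mu]_x (f x * (normal_pdf m s x)%:E))%E.
Proof.
move=> f0 mf.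
have dom := normal_prob_dominates m s.
rewrite -(Radon_Nikodym_SigmaFinite.change_of_variables dom)//.
have mpdf : measurable_fun setT (fun x => (normal_pdf m s x)%:E).
  by apply/measurable_EFinP; exact: measurable_normal_pdf.
have irn := Radon_Nikodym_SigmaFinite.f_integrable dom.
apply: ae_eq_integral => //.
- apply: emeasurable_funM => //; exact: (measurable_int mu).
- exact: emeasurable_funM.
- apply: ae_eqe_mul2l => /=; apply: integral_ae_eq => //=.
  by move=> E _ mE; rewrite -Radon_Nikodym_SigmaFinite.f_integral.
Qed.

Lemma integral_normal_prob (m s : R) (h : R -> R) :
  measurable_fun setT h ->
  mu.-integrable setT (fun x => (h x * normal_pdf m s x)%:E) ->
  (normal_prob m s).-integrable setT (EFin \o h) /\
  \int[normal_prob m s]_x h x = \int[mu]_x (h x * normal_pdf m s x).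
Proof.
move=> mh ih.
have mEh : measurable_fun setT (EFin \o h) by exact/measurable_EFinP.
have i1 : (normal_prob m s).-integrable setT (EFin \o h).
  apply/integrableP; split => //.
  rewrite ge0_integral_normal_prob//; last exact: measurableT_comp.
  have /integrableP[_] := ih; apply: le_lt_trans.
  rewrite le_eqVlt; apply/orP; left; apply/eqP; apply: eq_integral => x _ /=.
  by rewrite -EFinM normrM [`|normal_pdf _ _ _|]ger0_norm// normal_pdf_ge0.
split => //; rewrite /Rintegral; congr fine.
rewrite integralE [in RHS]integralE.
congr (_ - _)%E; (rewrite ge0_integral_normal_prob//;
  [|exact: measurable_funepos || exact: measurable_funeneg]);
  apply: eq_integral => x _;
  rewrite ?funeposE ?funenegE /= -?EFinN -!EFin_max -EFinM maxr_pMl ?normal_pdf_ge0//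
    ?mul0r ?mulNr//.
Qed.

(** The expectation of h under [gaussian_law m s]. *)
Definition gaussian_mean (m s : R) (h : R -> R) : R :=
  if s == 0 then h m else \int[mu]_x (h x * normal_pdf m s x).

(** [lebesgue_measure] lives on the Borel structure [measurableTypeR R], whose
    display differs from that of R; hence the copy X' of X in the proof. *)
Lemma gaussian_law_integral (dT : measure_display) (T : measurableType dT)
    (P : probability T R) (X : T -> R) (m s C : R) (h : R -> R) :
  measurable_fun setT X -> 0 <= s ->
  (forall B : set R, measurable B -> P (X @^-1` B) = gaussian_law m s B) ->
  measurable_fun setT h -> (forall x, `|h x| <= C * (1 + (x - m) ^+ 2)) ->
  P.-integrable setT (EFin \o (h \o X)) /\
  \int[P]_w h (X w) = gaussian_mean m s h.
Proof.
move=> mX0 s_ge0 lawX0 mh hC.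
pose X' : T -> measurableTypeR R := X.
have mX : measurable_fun setT X' by exact: mX0.
have lawX (B : set (measurableTypeR R)) : measurable B ->
  P (X' @^-1` B) = gaussian_law m s B := lawX0 B.
have mEh : measurable_fun setT (EFin \o h) by exact/measurable_EFinP.
have [i1 e1] : P.-integrable setT (EFin \o (h \o X')) /\
    (\int[pushforward P X']_x (h x)%:E = (gaussian_mean m s h)%:E)%E.
  rewrite /gaussian_mean; case: ifPn => s0.
    have e (f : R -> \bar R) : measurable_fun setT f ->
        (\int[pushforward P X']_x f x = f m)%E.
      move=> mf.
      transitivity (\int[\d_(m : measurableTypeR R)]_x f x)%E.
        apply: eq_measure_integral => A mA _.
        by have := lawX A mA; rewrite /gaussian_law s0.
      by rewrite integral_dirac// diracT mul1e.
    split; last by rewrite e.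
    apply/integrableP; split.
      by apply/measurable_EFinP; exact: measurableT_comp.
    have := @ge0_integral_pushforward _ _ _ _ _ _ mX P setT (fun x : measurableTypeR R => `|(h x)%:E|)%E measurableT.
    rewrite preimage_setT => <- //; last exact: measurableT_comp.
    by rewrite e ?ltry//; exact: measurableT_comp.
  have s1 : 0 < s by rewrite lt_def s0.
  have e (f : R -> \bar R) :
      (\int[pushforward P X']_x f x = \int[normal_prob m s]_x f x)%E.
    apply: eq_measure_integral.
    by move=> A mA _; have := lawX A mA; rewrite /gaussian_law (negbTE s0).
  have ih := integrable_normal_quad s1 mh hC.
  have [j1 j2] := integral_normal_prob mh ih.
  split; last first.
    by rewrite e -j2 /Rintegral fineK//; exact: integrable_fin_num.
  apply/integrableP; split.
    by apply/measurable_EFinP; exact: measurableT_comp.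
  have := @ge0_integral_pushforward _ _ _ _ _ _ mX P setT (fun x : measurableTypeR R => `|(h x)%:E|)%E measurableT.
  rewrite preimage_setT => <- //; last exact: measurableT_comp.
  by rewrite e; case/integrableP : j1.
split => //; rewrite /Rintegral.
have := @integral_pushforward _ _ _ _ _ _ mX P setT (EFin \o h) mEh.
by rewrite preimage_setT => /(_ i1 measurableT) /= <-; rewrite e1.
Qed.

End gauss2.

(** * Mean, variance and cosine transform of a Gaussian law *)

Section gauss3.
Context {R : realType}.
Notation mu := (@lebesgue_measure R).

Lemma le_1Dsqr (x : R) : `|x| <= 1 + x ^+ 2.
Proof. by rewrite -real_normK ?num_real//; have := sqr_ge0 (`|x| - 1); nra. Qed.

(** Stein's identity for G = 1. *)
Lemma gaussian_mean_centered (m s : R) : 0 <= s ->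
  gaussian_mean m s (fun x => x - m) = 0.
Proof.
move=> s0; rewrite /gaussian_mean; case: ifPn => [_|sn0]; first by rewrite subrr.
have s1 : 0 < s by rewrite lt_def sn0.
have := @normal_stein R m s (cst 1) (cst 0) 1 s1 _ _ _ _ _.
rewrite /cst/= => H.
have e : \int[mu]_x (0 * normal_pdf m s x) = 0 :> R.
  rewrite (@eq_Rintegral _ _ _ _ _ (cst 0)); last by move=> x _; rewrite /= mul0r.
  by rewrite /Rintegral integral0.
rewrite e in H.
have /eqP : 0 = (s ^+ 2)^-1 * \int[mu]_x ((x - m) * 1 * normal_pdf m s x).
  apply: H.
  - by move=> x; exact: cvg_cst.
  - by move=> x; rewrite normr1 mul1r lerDl sqr_ge0.
  - by move=> x; rewrite normr0 mul1r addr_ge0 ?sqr_ge0.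
  - by move=> x; rewrite mulr1 mul1r le_1Dsqr.
rewrite eq_sym mulf_eq0 invr_eq0 sqrf_eq0 (negbTE sn0) /= => /eqP <-.
by apply: eq_Rintegral => x _; rewrite mulr1.
Qed.

(** Stein's identity for G = x - m. *)
Lemma gaussian_mean_sqr_centered (m s : R) : 0 <= s ->
  gaussian_mean m s (fun x => (x - m) ^+ 2) = s ^+ 2.
Proof.
move=> s0; rewrite /gaussian_mean; case: ifPn => [/eqP->|sn0].
  by rewrite subrr.
have s1 : 0 < s by rewrite lt_def sn0.
have := @normal_stein R m s (fun x => x - m) (cst 1) 1 s1 _ _ _ _ _.
rewrite /cst/= => H.
have e : \int[mu]_x (1 * normal_pdf m s x) = 1 :> R.
  have -> : \int[mu]_x (1 * normal_pdf m s x) = \int[mu]_x normal_pdf m s x.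
    by apply: eq_Rintegral => x _; rewrite mul1r.
  by rewrite /Rintegral integral_normal_pdf.
rewrite e in H.
have : 1 = (s ^+ 2)^-1 * \int[mu]_x ((x - m) * (x - m) * normal_pdf m s x).
  apply: H.
  - by move=> x; apply: is_derive_eq; rewrite subr0.
  - by move=> x; exact: cvg_cst.
  - by move=> x; rewrite mul1r le_1Dsqr.
  - by move=> x; rewrite normr1 mul1r lerDl sqr_ge0.
  - by move=> x; rewrite mul1r normrM -expr2 real_normK ?num_real// lerDr.
move=> h; rewrite -[RHS]mulr1 h mulrA mulfV ?mul1r ?sqrf_eq0//.
Qed.

(** By Stein's identity for G = sin(k + v (x - m)), the expectation phi(v)
    satisfies phi' = - s^2 v phi, so phi(v) exp(v^2 s^2 / 2) is constant. *)
Lemma gaussian_mean_cos_centered (m s k v : R) : 0 <= s ->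
  gaussian_mean m s (fun x => cos (k + v * (x - m))) =
  cos k * expR (- (v ^+ 2 * s ^+ 2 / 2)).
Proof.
move=> s0; rewrite /gaussian_mean; case: ifPn => [/eqP->|sn0].
  by rewrite subrr mulr0 addr0 expr0n/= mulr0 mul0r oppr0 expR0 mulr1.
have s1 : 0 < s by rewrite lt_def sn0.
pose f (u x : R) : R := cos (k + u * (x - m)) * normal_pdf m s x.
pose g (u x : R) : R := - (x - m) * sin (k + u * (x - m)) * normal_pdf m s x.
pose phi (u : R) : R := \int[mu]_x f u x.
have darg (u x : R) : is_derive u 1 (fun u : R => k + u * (x - m)) (x - m).
  have := der_add (is_derive_cst k u (1 : R)) (der_mul (is_derive_id u (1 : R)) (is_derive_cst (x - m) u (1 : R))).
  by move=> h; apply: (der_ext h) => //=; rewrite /cst; ring.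
have df (u x : R) : is_derive u 1 (f ^~ x) (g u x).
  have h := der_mul (is_derive1_comp (is_derive_cos _) (darg u x))
    (is_derive_cst (normal_pdf m s x) u (1 : R)).
  by apply: (der_ext h) => //=; rewrite /g; ring.
have dx (u x : R) : is_derive x 1 (fun x : R => k + u * (x - m)) u.
  have h1 : is_derive x 1 (fun y : R => y - m) 1.
    by apply: is_derive_eq; rewrite subr0.
  have h := der_add (is_derive_cst k x (1 : R)) (der_mul (is_derive_cst u x (1 : R)) h1).
  by apply: (der_ext h) => //=; rewrite /cst; ring.
have dG (u x : R) : is_derive x 1 (fun x : R => sin (k + u * (x - m))) (u * cos (k + u * (x - m))).
  have h := is_derive1_comp (is_derive_sin _) (dx u x).
  by apply: (der_ext h) => //=; ring.
have dC (u x : R) : is_derive x 1 (fun x : R => cos (k + u * (x - m))) (- u * sin (k + u * (x - m))).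
  have h := is_derive1_comp (is_derive_cos _) (dx u x).
  by apply: (der_ext h) => //=; ring.
have cC (u : R) : continuous (fun x : R => cos (k + u * (x - m))).
  move=> x; apply/differentiable_continuous/derivable1_diffP.
  exact: (@ex_derive _ _ _ _ _ _ _ (dC u x)).
have cS (u : R) : continuous (fun x : R => sin (k + u * (x - m))).
  move=> x; apply/differentiable_continuous/derivable1_diffP.
  exact: (@ex_derive _ _ _ _ _ _ _ (dG u x)).
have ub1 (x : R) : 1 <= 1 * (1 + x ^+ 2) by rewrite mul1r lerDl sqr_ge0.
have intf (u : R) : mu.-integrable setT (EFin \o f u).
  apply: (@integrable_normal_quad _ _ _ (fun x : R => cos (k + u * (x - m))) 1) => //.
    exact: continuous_measurable_fun.
  by move=> x; apply: le_trans (ub1 _); exact: cos_max.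
pose C (u : R) : R := `|u| + 1.
have stein (u : R) : \int[mu]_x (u * cos (k + u * (x - m)) * normal_pdf m s x) =
  (s ^+ 2)^-1 * \int[mu]_x ((x - m) * sin (k + u * (x - m)) * normal_pdf m s x).
  have C1 : 1 <= C u by rewrite lerDr.
  have CE (x : R) : `|x| <= C u * (1 + x ^+ 2).
    by apply: (le_trans (le_1Dsqr x)); rewrite ler_peMl// addr_ge0 ?sqr_ge0.
  apply: (@normal_stein R m s _ _ (C u)) => //.
  - by move=> x; apply: cvgM; [exact: cvg_cst|exact: cC].
  - move=> x; apply: (le_trans (sin_max _)); apply: (le_trans (ub1 (x - m))).
    by rewrite ler_wpM2r// addr_ge0 ?sqr_ge0.
  - move=> x; rewrite normrM; apply: (@le_trans _ _ (C u * 1)).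
      by apply: ler_pM => //; [rewrite lerDl|exact: cos_max].
    rewrite ler_wpM2l//; first by rewrite (le_trans _ C1).
    by rewrite lerDl sqr_ge0.
  - move=> x; rewrite normrM; apply: (@le_trans _ _ (`|x - m| * 1)); last first.
      by rewrite mulr1.
    by rewrite ler_wpM2l//; exact: sin_max.
have dphi (u : R) : is_derive u 1 phi (- (s ^+ 2 * u) * phi u).
  have Iu : `]u - 1, u + 1[%classic u by rewrite /= in_itv/=; lra.
  pose B (x : R) : R := (1 + (x - m) ^+ 2) * normal_pdf m s x.
  have B0 x : 0 <= B x by rewrite mulr_ge0 ?normal_pdf_ge0// addr_ge0 ?sqr_ge0.
  have iB : mu.-integrable setT (EFin \o B).
    apply: (@integrable_normal_quad _ _ _ (fun x => 1 + (x - m) ^+ 2) 1) => //.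
      apply: measurable_funD => //; apply: measurable_funX.
      exact: measurable_funB.
    by move=> x; rewrite mul1r ger0_norm// addr_ge0 ?sqr_ge0.
  have pE w x : partial1of2 f w x = g w x.
    by rewrite partial1of2E (@derive_val _ _ _ _ _ _ _ (df w x)).
  have gB w x : `]u - 1, u + 1[%classic w -> setT x -> `|partial1of2 f w x| <= B x.
    move=> _ _; rewrite pE /g /B normrM [`|normal_pdf m s x|]ger0_norm ?normal_pdf_ge0//.
    rewrite ler_wpM2r ?normal_pdf_ge0// normrM normrN.
    apply: (@le_trans _ _ (`|x - m| * 1)); last by rewrite mulr1 le_1Dsqr.
    by rewrite ler_wpM2l//; exact: sin_max.
  have dfa w x : `]u - 1, u + 1[%classic w -> setT x -> derivable (f ^~ x) w 1.
    by move=> _ _; exact: (@ex_derive _ _ _ _ _ _ _ (df w x)).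
  have H1 := derivable_under_integral measurableT Iu (fun w _ => intf w) dfa B0 iB gB.
  have H2 := differentiation_under_integral measurableT Iu (fun w _ => intf w) dfa B0 iB gB.
  apply: DeriveDef; first exact: H1.
  rewrite -derive1E H2 /phi /f.
  have -> : \int[mu]_y (partial1of2 f)^~ y u =
     \int[mu]_x (-1 * ((x - m) * sin (k + u * (x - m)) * normal_pdf m s x)).
    by apply: eq_Rintegral => x _; rewrite pE /g; ring.
  rewrite RintegralZl//; last first.
    apply: (@integrable_normal_quad _ _ _ (fun x => (x - m) * sin (k + u * (x - m))) 1) => //.
      apply: measurable_funM; first exact: measurable_funB.
      exact: continuous_measurable_fun.
    move=> x; rewrite mul1r; apply: le_trans (le_1Dsqr _); rewrite normrM ler_piMr//.
    exact: sin_max.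
  have -> : \int[mu]_x ((x - m) * sin (k + u * (x - m)) * normal_pdf m s x) =
    s ^+ 2 * \int[mu]_x (u * cos (k + u * (x - m)) * normal_pdf m s x).
    by rewrite stein mulrA mulfV ?mul1r// sqrf_eq0.
  have -> : \int[mu]_x (u * cos (k + u * (x - m)) * normal_pdf m s x) = u * phi u.
    rewrite /phi -(@RintegralZl _ (measurableTypeR R) _ mu _ (f u) u measurableT (intf u)).
    by apply: eq_Rintegral => x _; rewrite /f mulrA.
  rewrite /phi /f; ring.
pose psi (u : R) : R := phi u * expR (u ^+ 2 * s ^+ 2 / 2).
have dq (u : R) : is_derive u 1 (fun u : R => u ^+ 2 * s ^+ 2 / 2) (s ^+ 2 * u).
  have h := der_mul (der_mul (is_derive_id u (1 : R)) (is_derive_id u (1 : R)))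
     (is_derive_cst (s ^+ 2 / 2) u (1 : R)).
  by apply: (der_ext h) => [y|] /=; rewrite /cst/=; field.
have dpsi (u : R) : is_derive u (1 : R) psi 0.
  have h := der_mul (dphi u) (is_derive1_comp (@is_derive_expR R _) (dq u)).
  by apply: (der_ext h) => //=; ring.
have := is_derive_0_is_cst v 0 dpsi.
rewrite /psi expr0n/= !mul0r expR0 mulr1 => H.
have phi0 : phi 0 = cos k.
  rewrite /phi /f.
  have -> : \int[mu]_x (cos (k + 0 * (x - m)) * normal_pdf m s x) =
    \int[mu]_x (cos k * normal_pdf m s x).
    by apply: eq_Rintegral => x _; rewrite mul0r addr0.
  rewrite RintegralZl//; last exact: integrable_normal_pdf.
  by rewrite /Rintegral integral_normal_pdf mulr1.
by rewrite -[LHS]/(phi v) -phi0 -H expRN mulfK// gt_eqF// expR_gt0.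
Qed.

End gauss3.

(** * Moments and cosine transform of a Gaussian vector *)

Section expectations.
Context {R : realType} (dT : measure_display) (T : measurableType dT).
Variable P : probability T R.
Implicit Types f g : T -> R.

Definition integ f := P.-integrable setT (EFin \o f).
Notation E f := (Rintegral P setT f).

Lemma integ_measurable f : integ f -> measurable_fun setT f.
Proof. by move=> /measurable_int/measurable_EFinP. Qed.

Lemma integD f g : integ f -> integ g -> integ (fun w => f w + g w).
Proof. by move=> hf hg; exact: (integrableD measurableT hf hg). Qed.

Lemma integZ k f : integ f -> integ (fun w => k * f w).
Proof. by move=> hf; exact: (integrableZl measurableT k hf). Qed.

Lemma integB f g : integ f -> integ g -> integ (fun w => f w - g w).
Proof. by move=> hf hg; exact: (integrableB measurableT hf hg). Qed.

Lemma integ_cst k : integ (fun=> k).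
Proof. exact: finite_measure_integrable_cst. Qed.

Lemma integ_le f g : measurable_fun setT f -> (forall w, `|f w| <= g w) ->
  integ g -> integ f.
Proof.
move=> mf fg; apply: le_integrable => //; first exact/measurable_EFinP.
move=> w _; rewrite /= lee_fin; apply: (le_trans (fg w)); exact: ler_norm.
Qed.

Lemma integ_bounded f M : measurable_fun setT f -> (forall w, `|f w| <= M) -> integ f.
Proof. by move=> mf fM; apply: (integ_le mf fM); exact: integ_cst. Qed.

Lemma integ_norm f : integ f -> integ (fun w => `|f w|).
Proof. by move=> hf; exact: integrable_norm. Qed.

Lemma integ_sum (K : finType) (f : K -> T -> R) :
  (forall k, integ (f k)) -> integ (fun w => \sum_k f k w).
Proof.
move=> hf; rewrite /index_enum; elim: (Finite.enum K) => [|k s IH].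
  by under eq_fun do rewrite big_nil; exact: integ_cst.
by under eq_fun do rewrite big_cons; exact: integD.
Qed.

Lemma expectD f g : integ f -> integ g -> E (fun w => f w + g w) = E f + E g.
Proof. by move=> hf hg; exact: RintegralD. Qed.

Lemma expectB f g : integ f -> integ g -> E (fun w => f w - g w) = E f - E g.
Proof. by move=> hf hg; exact: RintegralB. Qed.

Lemma expectZ k f : integ f -> E (fun w => k * f w) = k * E f.
Proof. by move=> hf; exact: RintegralZl. Qed.

Lemma expect_cst k : E (fun=> k) = k.
Proof.
by have := @Rintegral_cst _ _ _ P setT measurableT k; rewrite /= probability_setT mulr1.
Qed.

Lemma expect_sum (K : finType) (f : K -> T -> R) :
  (forall k, integ (f k)) -> E (fun w => \sum_k f k w) = \sum_k E (f k).
Proof.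
move=> hf; rewrite /index_enum.
suff H (s : seq K) : integ (fun w => \sum_(k <- s) f k w) /\
    E (fun w => \sum_(k <- s) f k w) = \sum_(k <- s) E (f k).
  by case: (H (Finite.enum K)).
elim: s => [|k s [IH1 IH2]].
  split; first by under eq_fun do rewrite big_nil; exact: integ_cst.
  rewrite big_nil -[RHS](expect_cst 0).
  by apply: eq_Rintegral => w _; rewrite big_nil.
split; first by under eq_fun do rewrite big_cons; exact: integD.
rewrite big_cons -IH2 -expectD//.
by apply: eq_Rintegral => w _; rewrite big_cons.
Qed.

Lemma expect_le f g : integ f -> integ g -> (forall w, f w <= g w) -> E f <= E g.
Proof. by move=> hf hg fg; apply: le_Rintegral => // w _; exact: fg. Qed.

Lemma expect_norm_le f : integ f -> `|E f| <= E (fun w => `|f w|).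
Proof. by move=> hf; exact: le_normr_Rintegral. Qed.

End expectations.

Section gaussian_vector_moments.
Context {R : realType} (dT : measure_display) (T : measurableType dT).
Variables (P : probability T R) (d : nat) (W : 'I_d -> {RV P >-> R}).
Hypothesis gaussW : gaussian_vector W.
Notation E f := (Rintegral P setT f).

Definition vmean (i : 'I_d) : R := \int[P]_w W i w.
Definition vcov (i j : 'I_d) : R :=
  \int[P]_w ((W i w - vmean i) * (W j w - vmean j)).

Lemma measurable_comb (a : 'I_d -> R) :
  measurable_fun setT (fun w => \sum_i a i * W i w).
Proof. by apply: measurable_sum => i; exact: measurable_funM. Qed.

Lemma gaussian_integ_sqr i : integ P (fun w => W i w ^+ 2).
Proof.
have [M [s [s0 law]]] := gaussW (fun j => (j == i)%:R).
have e : (fun w => \sum_j (j == i)%:R * W j w) = W i.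
  apply/funext => w; rewrite (bigD1 i)//= eqxx mul1r big1 ?addr0// => j ji.
  by rewrite (negbTE ji) mul0r.
rewrite e in law.
have mW : measurable_fun setT (W i) by [].
have [||//] := @gaussian_law_integral R _ _ P (W i) M s (2 + 2 * M ^+ 2)
  (fun x => x ^+ 2) mW s0 law.
- exact: (@measurable_funX _ _ _ _ id).
- move=> x; rewrite ger0_norm ?sqr_ge0//.
  have := sqr_ge0 (x - 2 * M); have := sqr_ge0 (M * (x - M)); have := sqr_ge0 M.
  nra.
Qed.

Lemma gaussian_integ i : integ P (W i).
Proof.
apply: (@integ_le _ _ _ _ _ (fun w => 1 + W i w ^+ 2)) => // [w|].
  exact: le_1Dsqr.
by apply: integD; [exact: integ_cst|exact: gaussian_integ_sqr].
Qed.

Lemma gaussian_integ_centered i : integ P (fun w => W i w - vmean i).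
Proof. by apply: integB; [exact: gaussian_integ|exact: integ_cst]. Qed.

Lemma gaussian_integ_prod i j :
  integ P (fun w => (W i w - vmean i) * (W j w - vmean j)).
Proof.
have sq k : integ P (fun w => (W k w - vmean k) ^+ 2).
  apply: (@integ_le _ _ _ _ _ (fun w => 2 * W k w ^+ 2 + 2 * vmean k ^+ 2)) => [|w|].
  - by apply: measurable_funX; exact: measurable_funB.
  - rewrite ger0_norm ?sqr_ge0//; have := sqr_ge0 (W k w + vmean k); nra.
  - by apply: integD; [apply: integZ; exact: gaussian_integ_sqr|exact: integ_cst].
apply: (@integ_le _ _ _ _ _ (fun w => (W i w - vmean i) ^+ 2 + (W j w - vmean j) ^+ 2)) => [|w|].
- by apply: measurable_funM; exact: measurable_funB.
- rewrite normrM -[X in _ <= X + _]real_normK ?num_real//.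
  rewrite -[X in _ <= _ + X]real_normK ?num_real//.
  have := sqr_ge0 (`|W i w - vmean i| - `|W j w - vmean j|).
  have : 0 <= `|W i w - vmean i| by [].
  have : 0 <= `|W j w - vmean j| by [].
  nra.
- by apply: integD; exact: sq.
Qed.

Lemma vcovC i j : vcov i j = vcov j i.
Proof. by apply: eq_Rintegral => w _; rewrite mulrC. Qed.

(** Vectors with equal means have increments whose second moments differ only
    through the covariances. *)
Lemma expect_incr_sqr i j : \int[P]_w ((W i w - W j w) ^+ 2) =
  vcov i i + vcov j j - 2 * vcov i j + (vmean i - vmean j) ^+ 2.
Proof.
pose Y k w := W k w - vmean k.
have iY k : integ P (Y k) by exact: gaussian_integ_centered.
have iYY k l : integ P (fun w => Y k w * Y l w) by exact: gaussian_integ_prod.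
have EY k : \int[P]_w Y k w = 0.
  by rewrite expectB ?expect_cst ?subrr//; [exact: gaussian_integ|exact: integ_cst].
pose c := vmean i - vmean j.
have -> : \int[P]_w ((W i w - W j w) ^+ 2) =
  \int[P]_w ((Y i w * Y i w + Y j w * Y j w + (-2) * (Y i w * Y j w)) +
     (2 * c * (Y i w - Y j w) + c ^+ 2)).
  by apply: eq_Rintegral => w _; rewrite /Y /c; ring.
have i1 := integD (iYY i i) (iYY j j).
have i2 := integZ (-2) (iYY i j).
have i3 := integB (iY i) (iY j).
have i4 := integZ (2 * c) i3.
rewrite (expectD (integD i1 i2) (integD i4 (integ_cst P (c ^+ 2)))).
rewrite (expectD i1 i2) (expectD (iYY i i) (iYY j j)) (expectZ _ (iYY i j)).
rewrite (expectD i4 (integ_cst P (c ^+ 2))) (expectZ _ i3) (expectB (iY i) (iY j)).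
rewrite !EY expect_cst /vcov -/(Y i) -/(Y j) /c; ring.
Qed.

(** The phase k makes one formula cover cosines and sines, and lets it be
    applied again to the result when two independent vectors are added. *)
Lemma gaussian_cos (a : 'I_d -> R) (k : R) :
  \int[P]_w cos (k + \sum_i a i * (W i w - vmean i)) =
  cos k * expR (- ((\sum_i \sum_j vcov i j * (a i * a j)) / 2)).
Proof.
have [M [s [s0 law]]] := gaussW a.
pose S w := \sum_i a i * W i w.
have mS : measurable_fun setT S by exact: measurable_comb.
have iS : integ P S by apply: integ_sum => i; apply: integZ; exact: gaussian_integ.
have M_E : M = \sum_i a i * vmean i.
  have [||_] := @gaussian_law_integral R _ _ P S M s 1 (fun x => x - M) mS s0 law.
  - exact: measurable_funB.
  - by move=> x; rewrite mul1r le_1Dsqr.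
  rewrite gaussian_mean_centered// expectB ?expect_cst//; last exact: integ_cst.
  move=> /eqP; rewrite subr_eq0 => /eqP <-.
  rewrite expect_sum => [|i]; last by apply: integZ; exact: gaussian_integ.
  by apply: eq_bigr => i _; rewrite expectZ//; exact: gaussian_integ.
have cen w : S w - M = \sum_i a i * (W i w - vmean i).
  by rewrite M_E -sumrB; apply: eq_bigr => i _; rewrite mulrBr.
have s_E : s ^+ 2 = \sum_i \sum_j vcov i j * (a i * a j).
  have [||_] := @gaussian_law_integral R _ _ P S M s 1 (fun x => (x - M) ^+ 2) mS s0 law.
  - by apply: measurable_funX; exact: measurable_funB.
  - by move=> x; rewrite mul1r ger0_norm ?sqr_ge0// lerDr.
  rewrite gaussian_mean_sqr_centered// => <-.
  have -> : \int[P]_w (S w - M) ^+ 2 = \int[P]_w (\sum_i \sum_j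
     (a i * a j) * ((W i w - vmean i) * (W j w - vmean j))).
    apply: eq_Rintegral => w _; rewrite cen expr2 mulr_suml; apply: eq_bigr => i _.
    by rewrite mulr_sumr; apply: eq_bigr => j _; ring.
  rewrite expect_sum => [|i]; last first.
    by apply: integ_sum => j; apply: integZ; exact: gaussian_integ_prod.
  apply: eq_bigr => i _; rewrite expect_sum => [|j]; last first.
    by apply: integZ; exact: gaussian_integ_prod.
  by apply: eq_bigr => j _; rewrite (expectZ _ (gaussian_integ_prod i j)) mulrC.
have [||_] := @gaussian_law_integral R _ _ P S M s 1 (fun x => cos (k + 1 * (x - M))) mS s0 law.
- apply: (@measurableT_comp _ _ _ _ _ _ (@cos R)).
    by apply: continuous_measurable_fun; exact: continuous_cos.
  apply: measurable_funD => //; apply: measurable_funM => //.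
  exact: measurable_funB.
- by move=> x; apply: (le_trans (cos_max _)); rewrite mul1r lerDl sqr_ge0.
rewrite gaussian_mean_cos_centered// expr1n mul1r s_E => <-.
by apply: eq_Rintegral => w _; rewrite mul1r cen.
Qed.

End gaussian_vector_moments.

(** * Second-order jets and their uniform approximation by trigonometric polynomials *)

Section jets.
Context {R : realType} {I : finType}.
Variable A : I -> I -> R.
Hypothesis Asym : forall i j, A i j = A j i.

(** The quadratic form of the operator L = 1/2 sum A_ij d_i d_j: its defect from
    being a derivation is L(fg) - f Lg - g Lf = 2 bil (grad f) (grad g). *)
Definition bil (g h : I -> R) : R := 2^-1 * \sum_i \sum_j A i j * (g i * h j).

Lemma bilC g h : bil g h = bil h g.
Proof.
rewrite /bil; congr (_ * _); rewrite exchange_big; apply: eq_bigr => i _ /=.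
by apply: eq_bigr => j _; rewrite Asym [h i * _]mulrC.
Qed.

Lemma bilDl g g' h : bil (fun i => g i + g' i) h = bil g h + bil g' h.
Proof.
rewrite /bil -mulrDr -big_split/=; congr (_ * _); apply: eq_bigr => i _.
by rewrite -big_split/=; apply: eq_bigr => j _; ring.
Qed.

Lemma bilZl k g h : bil (fun i => k * g i) h = k * bil g h.
Proof.
rewrite /bil mulrCA [k * _]big_distrr/=; congr (_ * _); apply: eq_bigr => i _.
by rewrite big_distrr/=; apply: eq_bigr => j _; ring.
Qed.

Lemma bilDr g h h' : bil g (fun i => h i + h' i) = bil g h + bil g h'.
Proof. by rewrite bilC bilDl !(bilC g). Qed.

Lemma bilZr k g h : bil g (fun i => k * h i) = k * bil g h.
Proof. by rewrite bilC bilZl bilC. Qed.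

Definition bil_norm : R := 2^-1 * \sum_i \sum_j `|A i j|.

Lemma bil_norm_ge0 : 0 <= bil_norm.
Proof. by rewrite mulr_ge0// ?invr_ge0//; do 2 apply: sumr_ge0 => ? _. Qed.

Lemma bil_le g h a b : (forall i, `|g i| <= a) -> (forall i, `|h i| <= b) ->
  `|bil g h| <= bil_norm * (a * b).
Proof.
move=> ga hb; rewrite /bil /bil_norm normrM gtr0_norm ?invr_gt0// -mulrA.
rewrite ler_wpM2l ?invr_ge0// (le_trans (ler_norm_sum _ _ _))// mulr_suml.
apply: ler_sum => i _; rewrite (le_trans (ler_norm_sum _ _ _))// mulr_suml.
by apply: ler_sum => j _; rewrite !normrM ler_wpM2l// ler_pM.
Qed.

(** Value, gradient and L-value of a function at a point. Keeping the single
    number L f instead of the Hessian is enough, since products and composition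
    with functions of one variable involve no other second-order term. *)
Record jet := Jet { jv : R ; jg : I -> R ; jl : R }.

Lemma jetP a b : jv a = jv b -> jg a =1 jg b -> jl a = jl b -> a = b.
Proof. by case: a b => [v g l] [v' g' l'] /= -> /funext -> ->. Qed.

Definition jadd a b :=
  Jet (jv a + jv b) (fun i => jg a i + jg b i) (jl a + jl b).
Definition jscale k a := Jet (k * jv a) (fun i => k * jg a i) (k * jl a).
(** Leibniz rule. *)
Definition jmul a b :=
  Jet (jv a * jv b) (fun i => jv a * jg b i + jv b * jg a i)
      (jv a * jl b + jv b * jl a + 2 * bil (jg a) (jg b)).
Definition jsub a b := jadd a (jscale (-1) b).
Definition jcst c := Jet c (fun=> 0) 0.
(** Chain rule for a function p of one variable with derivatives p1 and p2. *)
Definition jcomp (p p1 p2 : R -> R) a :=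
  Jet (p (jv a)) (fun i => p1 (jv a) * jg a i)
      (p1 (jv a) * jl a + p2 (jv a) * bil (jg a) (jg a)).

Definition jbd (M : R) a :=
  [/\ `|jv a| <= M, (forall i, `|jg a i| <= M) & `|jl a| <= M].

Lemma jbdD M N a b : jbd M a -> jbd N b -> jbd (M + N) (jadd a b).
Proof.
case=> ? ? ? [? ? ?]; split=> [|i|] /=;
  by rewrite (le_trans (ler_normD _ _))// lerD.
Qed.

Lemma jbdZ M k a : jbd M a -> jbd (`|k| * M) (jscale k a).
Proof. by case=> ? ? ?; split=> [|i|] /=; rewrite normrM ler_wpM2l. Qed.

Lemma jbd_ge0 M a : jbd M a -> 0 <= M.
Proof. by case=> h _ _; exact: le_trans h. Qed.

Lemma jbdM M N a b : jbd M a -> jbd N b ->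
  jbd ((2 + 2 * bil_norm) * (M * N)) (jmul a b).
Proof.
move=> ja jb; have M0 := jbd_ge0 ja; have N0 := jbd_ge0 jb.
case: ja jb => av ag al [bv bg bl].
have MN : 0 <= M * N by rewrite mulr_ge0.
have K0 := bil_norm_ge0; have KMN : 0 <= bil_norm * (M * N) by rewrite mulr_ge0.
have le x y : `|x| <= M -> `|y| <= N -> `|x * y| <= M * N.
  by move=> ? ?; rewrite normrM ler_pM.
split=> [|i|] /=.
- by apply: (le_trans (le _ _ av bv)); lra.
- have h1 := le _ _ av (bg i); have h2 := le _ _ (ag i) bv.
  rewrite (le_trans (ler_normD _ _))//; rewrite [jv b * _]mulrC; lra.
- have h1 := le _ _ av bl; have h2 := le _ _ al bv; rewrite mulrC in h2.
  have h3 := bil_le ag bg; have h4 := ler_normD (jv a * jl b) (jv b * jl a).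
  apply: (le_trans (ler_normD _ _)).
  rewrite [`|2 * _|]normrM [`|2|]ger0_norm//; lra.
Qed.

Lemma jbdW M N a : M <= N -> jbd M a -> jbd N a.
Proof.
by move=> MN [h1 h2 h3]; split=> [|i|]; apply: le_trans MN.
Qed.

Notation T := (I -> R).

(** The jet of cos(a.x + c). *)
Definition cosjet (a : T) (c : R) (x : T) : jet :=
  let u := \sum_i a i * x i + c in
  Jet (cos u) (fun i => - sin u * a i) (- bil a a * cos u).

(** Trigonometric polynomials with arbitrary real frequencies. Sines are covered
    by the phase c and constants by a = 0. *)
Inductive trig : (T -> jet) -> Prop :=
| trig_cos a c : trig (cosjet a c)
| trig_add p q : trig p -> trig q -> trig (fun x => jadd (p x) (q x))
| trig_scale k p : trig p -> trig (fun x => jscale k (p x)).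

(** Uniform closure of the trigonometric polynomials, in value, gradient and
    L-value together. A member is only a family of jets: its components are not
    required to be derivatives of its value. *)
Definition approx (f : T -> jet) :=
  forall e, 0 < e -> exists2 p, trig p & forall x, jbd e (jsub (p x) (f x)).

Lemma jsubxx a : jsub a a = jcst 0.
Proof. by apply: jetP => [|i|] /=; ring. Qed.

Lemma jbd0 M : 0 <= M -> jbd M (jcst 0).
Proof. by move=> M0; split=> [|i|] /=; rewrite normr0. Qed.

Lemma approx_trig p : trig p -> approx p.
Proof. by move=> tp e e0; exists p => // x; rewrite jsubxx; apply/jbd0/ltW. Qed.

Lemma trig_bounded p : trig p -> exists M, forall x, jbd M (p x).
Proof.
elim=> [a c|{}p q _ [M HM] _ [N HN]|k {}p _ [M HM]].
- exists (1 + \sum_i `|a i| + `|bil a a|) => x; rewrite /cosjet.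
  set u := \sum_i _ + c.
  have s0 : 0 <= \sum_i `|a i| by apply: sumr_ge0.
  have b0 : 0 <= `|bil a a| by [].
  split=> [|i|] /=.
  + by apply: (le_trans (cos_max _)); lra.
  + rewrite normrM normrN; apply: (@le_trans _ _ (1 * `|a i|)).
      by rewrite ler_wpM2r// sin_max.
    rewrite mul1r.
    have : `|a i| <= \sum_i `|a i|.
      by rewrite (bigD1 i)//= lerDl sumr_ge0.
    lra.
  + rewrite normrM normrN; apply: (@le_trans _ _ (`|bil a a| * 1)).
      by rewrite ler_wpM2l// cos_max.
    by rewrite mulr1; lra.
- by exists (M + N) => x; apply: jbdD.
- by exists (`|k| * M) => x; apply: jbdZ.
Qed.

Lemma jsub_trans a b c M N : jbd M (jsub a b) -> jbd N (jsub b c) ->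
  jbd (M + N) (jsub a c).
Proof.
move=> h1 h2; have := jbdD h1 h2; congr jbd.
by apply: jetP => [|i|] /=; ring.
Qed.

Lemma approx_bounded f : approx f -> exists M, forall x, jbd M (f x).
Proof.
move=> /(_ 1 ltr01)[p /trig_bounded[M HM] Hp]; exists (M + `|-1| * 1) => x.
have -> : f x = jadd (p x) (jscale (-1) (jsub (p x) (f x))).
  by apply: jetP => [|i|] /=; ring.
by apply: jbdD => //; apply: jbdZ.
Qed.

Lemma approx_closed f :
  (forall e, 0 < e -> exists2 p, approx p & forall x, jbd e (jsub (p x) (f x))) ->
  approx f.
Proof.
move=> h e e0; have e2 : 0 < e / 2 by rewrite divr_gt0.
have [p /(_ _ e2)[q tq Hq] Hp] := h _ e2.
exists q => // x; rewrite (splitr e); exact: jsub_trans (Hq x) (Hp x).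
Qed.

Lemma approx_add f g : approx f -> approx g -> approx (fun x => jadd (f x) (g x)).
Proof.
move=> hf hg e e0; have e2 : 0 < e / 2 by rewrite divr_gt0.
have [p tp Hp] := hf _ e2; have [q tq Hq] := hg _ e2.
exists (fun x => jadd (p x) (q x)) => [|x]; first exact: trig_add.
rewrite (splitr e); have := jbdD (Hp x) (Hq x); congr jbd.
by apply: jetP => [|i|] /=; ring.
Qed.

Lemma approx_scale k f : approx f -> approx (fun x => jscale k (f x)).
Proof.
move=> hf e e0; have k0 : 0 < `|k| + 1 by rewrite ltr_wpDl.
have e2 : 0 < e / (`|k| + 1) by rewrite divr_gt0.
have [p tp Hp] := hf _ e2.
exists (fun x => jscale k (p x)) => [|x]; first exact: trig_scale.
apply: (@jbdW (`|k| * (e / (`|k| + 1)))).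
  by rewrite mulrCA ler_piMr ?(ltW e0)// ler_pdivrMr// mul1r lerDl.
have := jbdZ k (Hp x); congr jbd.
by apply: jetP => [|i|] /=; ring.
Qed.

Lemma approx_cst c : approx (fun=> jcst c).
Proof.
have -> : (fun=> jcst c) = (fun x => jscale c (cosjet (fun=> 0) 0 x)) :> (T -> jet).
  apply/funext => x; rewrite /cosjet.
  have -> : \sum_i (0 * x i) + 0 = 0 :> R.
    by rewrite addr0 big1// => i _; rewrite mul0r.
  have -> : bil (fun=> 0) (fun=> 0) = 0.
    by rewrite /bil big1 ?mulr0// => i _; rewrite big1// => j _; rewrite !mulr0.
  by apply: jetP => [|i|] /=; rewrite ?cos0; ring.
exact/approx_scale/approx_trig/trig_cos.
Qed.

Lemma jmulDl a b c : jmul (jadd a b) c = jadd (jmul a c) (jmul b c).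
Proof. by apply: jetP => [|i|] /=; rewrite ?bilDl; ring. Qed.

Lemma jmulC a b : jmul a b = jmul b a.
Proof. by apply: jetP => [|i|] /=; rewrite ?(bilC (jg a)); ring. Qed.

Lemma jmulZl k a c : jmul (jscale k a) c = jscale k (jmul a c).
Proof. by apply: jetP => [|i|] /=; rewrite ?bilZl; ring. Qed.

Lemma jmul_sub a b a' b' : jsub (jmul a b) (jmul a' b') =
  jadd (jmul (jsub a a') b') (jmul a (jsub b b')).
Proof.
rewrite jmulDl jmulZl [jmul a (jadd _ _)]jmulC jmulDl jmulZl.
rewrite ![jmul _ a]jmulC.
by apply: jetP => [|i|] /=; ring.
Qed.

(** The product-to-sum formula holds at the level of jets, which is what makes
    the trigonometric polynomials an algebra. *)
Lemma cosjetM a c b e x : jmul (cosjet a c x) (cosjet b e x) =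
  jscale 2^-1 (jadd (cosjet (fun i => a i + b i) (c + e) x)
                    (cosjet (fun i => a i + -1 * b i) (c - e) x)).
Proof.
rewrite /cosjet; set u := \sum_i a i * x i + c; set w := \sum_i b i * x i + e.
have -> : \sum_i ((a i + b i) * x i) + (c + e) = u + w.
  under eq_bigr do rewrite mulrDl.
  by rewrite big_split/= addrACA.
have -> : \sum_i ((a i + -1 * b i) * x i) + (c - e) = u - w.
  under eq_bigr do rewrite mulrDl -mulrA.
  by rewrite big_split/= -mulr_sumr mulN1r opprD addrACA.
apply: jetP => [|i|] /=.
- by rewrite (cosB u w) (cosD u w); field.
- by rewrite (sinB u w) (sinD u w); field.
- have -> : bil (fun i => - sin u * a i) (fun i => - sin w * b i) =
     sin u * sin w * bil a b by rewrite bilZl bilZr; ring.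
  rewrite !(bilDl, bilDr) !(bilZl, bilZr) (bilC b a) (cosB u w) (cosD u w).
  by field.
Qed.

Lemma trig_mul p q : trig p -> trig q -> approx (fun x => jmul (p x) (q x)).
Proof.
elim=> [a c|p1 p2 _ h1 _ h2|k {}p _ h] tq.
- elim: tq => [b e|q1 q2 _ h1 _ h2|k {}q _ h].
  + under [X in approx X]eq_fun do rewrite cosjetM.
    by apply: approx_scale; apply: approx_add; apply/approx_trig/trig_cos.
  + under [X in approx X]eq_fun do rewrite jmulC jmulDl 2!(jmulC _ (cosjet _ _ _)).
    exact: approx_add.
  + under [X in approx X]eq_fun do rewrite jmulC jmulZl (jmulC _ (cosjet _ _ _)).
    exact: approx_scale.
- under [X in approx X]eq_fun do rewrite jmulDl.
  by apply: approx_add; [exact: h1|exact: h2].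
- under [X in approx X]eq_fun do rewrite jmulZl.
  by apply: approx_scale; exact: h.
Qed.

(** Jets of size at most M and N have a product of size at most a constant times
    M N, so multiplication is continuous on bounded families. *)
Lemma approx_mul f g : approx f -> approx g -> approx (fun x => jmul (f x) (g x)).
Proof.
move=> hf hg; apply: approx_closed => e e0.
have small K : 0 <= K -> exists2 d, 0 < d & (2 + 2 * bil_norm) * (d * K) <= e / 2.
  move=> K0; have B0 : 0 <= (2 + 2 * bil_norm) * K.
    by rewrite mulr_ge0// addr_ge0// mulr_ge0// bil_norm_ge0.
  have B1 : 0 < (2 + 2 * bil_norm) * K + 1 by rewrite ltr_wpDl.
  exists (e / 2 / ((2 + 2 * bil_norm) * K + 1)); first by rewrite !divr_gt0.
  rewrite mulrCA mulrAC ler_pdivrMr// ler_pM2l ?divr_gt0//.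
  by rewrite lerDl.
have [N HN] := approx_bounded hg.
have [d d0 dN] := small N (jbd_ge0 (HN (fun=> 0))).
have [p tp Hp] := hf _ d0.
have [M HM] := trig_bounded tp.
have [d' d'0 dM] := small M (jbd_ge0 (HM (fun=> 0))).
have [q tq Hq] := hg _ d'0.
exists (fun x => jmul (p x) (q x)) => [|x]; first exact: trig_mul.
rewrite jmul_sub (splitr e).
apply: jbdD.
  by apply: (jbdW dN); exact: jbdM.
apply: (@jbdW ((2 + 2 * bil_norm) * (M * d'))); last exact: jbdM.
by rewrite (mulrC M).
Qed.

Lemma approx_poly (q : {poly R}) f : approx f ->
  approx (fun x => jcomp (horner q) (horner q^`()) (horner q^`()^`()) (f x)).
Proof.
move=> hf; elim/poly_ind: q => [|q c IH].
  have -> : (fun x => jcomp (horner 0) (horner 0^`()) (horner 0^`()^`()) (f x)) = (fun=> jcst 0) :> (T -> jet).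
    by apply/funext => x; apply: jetP => [|i|] /=; rewrite ?deriv0 ?horner0; ring.
  exact: approx_cst.
rewrite (_ : (fun x => _) = fun x => jadd (jmul (jcomp (horner q) (horner q^`()) (horner q^`()^`()) (f x)) (f x)) (jcst c)).
  by apply: approx_add; [exact: approx_mul|exact: approx_cst].
apply/funext => x; apply: jetP => [|i|] /=;
  rewrite ?(derivD, derivM, derivX, derivC, hornerD, hornerM, hornerX, hornerC) ?bilZl;
  rewrite ?derivD ?derivM ?derivX ?derivC ?mulr1 ?addr0 ?derivD ?hornerD ?hornerM ?hornerX ?hornerC; ring.
Qed.

(** Polynomials in f are reached by the algebra structure, and polynomials
    approximate p with two derivatives on the set D of values of f. *)
Lemma approx_comp (D : R -> Prop) (p p1 p2 : R -> R) f :
  approx f -> (forall x, D (jv (f x))) ->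
  (forall e, 0 < e -> exists q : {poly R}, forall y, D y ->
     [/\ `|q.[y] - p y| <= e, `|q^`().[y] - p1 y| <= e
       & `|q^`()^`().[y] - p2 y| <= e]) ->
  approx (fun x => jcomp p p1 p2 (f x)).
Proof.
move=> hf Df hp; apply: approx_closed => e e0.
have [M HM] := approx_bounded hf; have M0 := jbd_ge0 (HM (fun=> 0)).
have K0 := bil_norm_ge0.
pose C := 1 + M + bil_norm * (M * M).
have KM : 0 <= bil_norm * (M * M) by rewrite mulr_ge0// mulr_ge0.
have C0 : 0 < C by rewrite /C; lra.
have d0 : 0 < e / C by rewrite divr_gt0.
have dC : e / C * C = e by rewrite divfK// gt_eqF.
have [q Hq] := hp _ d0.
exists (fun x => jcomp (horner q) (horner q^`()) (horner q^`()^`()) (f x)) => [|x].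
  exact: approx_poly.
have [q0 q1 q2] := Hq _ (Df x).
have [vM gM lM] := HM x.
have bM := bil_le gM gM.
rewrite -dC; set d := e / C in q0 q1 q2 *.
have dle a : a <= C -> d * a <= d * C by move=> ?; rewrite ler_wpM2l// ltW.
split=> [|i|] /=; rewrite mulN1r.
- apply: (le_trans q0); rewrite -[leLHS]mulr1 dle// /C; lra.
- rewrite -mulrBl normrM; apply: (@le_trans _ _ (d * M)); first exact: ler_pM.
  by rewrite dle// /C; lra.
- rewrite opprD addrACA -!mulrBl.
  rewrite (le_trans (ler_normD _ _))//.
  rewrite (normrM (_ - p1 _)) (normrM (_ - p2 _)).
  apply: (@le_trans _ _ (d * M + d * (bil_norm * (M * M)))).
    by apply: lerD; apply: ler_pM.
  by rewrite -mulrDr dle// /C; lra.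
Qed.

End jets.

(** * Polynomial approximation of exp and ln together with two derivatives *)

Section exp_poly.
Context {R : realType}.

Definition exp_poly (n : nat) : {poly R} := \sum_(k < n) (k`!%:R^-1) *: 'X^k.

Lemma deriv_exp_poly n : (exp_poly n.+1)^`() = exp_poly n.
Proof.
rewrite /exp_poly (big_morph _ (@derivD R) (deriv0 R)) big_ord_recl /=.
rewrite expr0 derivZ -polyC1 derivC scaler0 add0r.
apply: eq_bigr => k _; rewrite derivZ derivXn /= /bump add1n -(scaler_nat k.+1) scalerA.
by rewrite factS natrM invfM mulrC mulrA mulfV ?mul1r// pnatr_eq0.
Qed.

Lemma horner_exp_poly n y : (exp_poly n).[y] = series (exp_coeff y) n.
Proof.
rewrite /exp_poly horner_sum /series /= big_mkord; apply: eq_bigr => k _.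
by rewrite hornerZ hornerXn /exp_coeff mulrC.
Qed.

(** Termwise comparison of the tail of the series at y with that at M. *)
Lemma exp_poly_dist M n y : `|y| <= M ->
  `|(exp_poly n).[y] - expR y| <= expR M - (exp_poly n).[M].
Proof.
move=> yM; have M0 : 0 <= M by exact: le_trans yM.
pose S (z : R) := series (exp_coeff z); rewrite !horner_exp_poly -!/(S _).
have inc m k : (m <= k)%N -> S M m <= S M k.
  move=> mk; rewrite -subr_ge0 sub_series_geq// sumr_ge0// => i _.
  exact: exp_coeff_ge0.
have SM k : S M k <= expR M.
  by apply: nondecreasing_cvgn_le => //; exact: is_cvg_series_exp_coeff.
have dle m : (n <= m)%N -> `|S y m - S y n| <= expR M - S M n.
  move=> nm; apply: (@le_trans _ _ (S M m - S M n)); last by rewrite lerB.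
  rewrite !sub_series_geq// (le_trans (ler_norm_sum _ _ _))//.
  apply: ler_sum => i _; rewrite /exp_coeff normrM [`|_%:R^-1|]ger0_norm//.
  by rewrite ler_wpM2r// normrX lerXn2r// ?nnegrE.
rewrite distrC ler_norml; apply/andP; split.
  rewrite lerBrDl.
  apply: limr_ge; first exact: is_cvg_series_exp_coeff.
  near=> m; have /dle : (n <= m)%N by near: m; exact: nbhs_infty_ge.
  rewrite ler_norml -/(S y m) => /andP[]; lra.
rewrite lerBlDr.
apply: limr_le; first exact: is_cvg_series_exp_coeff.
near=> m; have /dle : (n <= m)%N by near: m; exact: nbhs_infty_ge.
rewrite ler_norml -/(S y m) => /andP[]; lra.
Unshelve. all: by end_near. Qed.

Lemma exp_poly_approx (M e : R) : 0 < e -> exists q : {poly R}, forall y, `|y| <= M ->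
  [/\ `|q.[y] - expR y| <= e, `|q^`().[y] - expR y| <= e
    & `|q^`()^`().[y] - expR y| <= e].
Proof.
move=> e0; have cv := is_cvg_series_exp_coeff M.
have /cvgrPdist_le/(_ _ e0)[N _ HN] := cv.
exists (exp_poly N.+2) => y yM; rewrite !deriv_exp_poly.
have h n : (N <= n)%N -> `|(exp_poly n).[y] - expR y| <= e.
  move=> Nn; apply: (le_trans (exp_poly_dist n yM)).
  by rewrite horner_exp_poly; apply: le_trans (ler_norm _) (HN n Nn).
by split; apply: h => //; rewrite leqW.
Qed.

(** With s = sqrt r, the quantity (n+1) s^n is bounded by Bernoulli's inequality
    and the remaining factor s^n tends to 0. *)
Lemma nat_mul_expr_small (r e : R) : 0 <= r < 1 -> 0 < e ->
  exists n : nat, n.+1%:R * r ^+ n <= e /\ r ^+ n.+1 <= e.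
Proof.
move=> /andP[r0 r1] e0.
have [->|rn0] := eqVneq r 0.
  by exists 1; rewrite !expr1 expr0n /= mulr0 ltW.
have rp : 0 < r by rewrite lt_def rn0.
pose s := Num.sqrt r; have s0 : 0 < s by rewrite sqrtr_gt0.
have sr : s * s = r by rewrite -expr2 sqr_sqrtr.
have s1 : s < 1 by rewrite -sqrtr1 ltr_sqrt.
pose h := s^-1 - 1; have h0 : 0 < h by rewrite subr_gt0 invf_gt1.
pose C := 1 + h^-1; have C0 : 0 < C by rewrite addr_gt0// invr_gt0.
have bnd n : n.+1%:R * s ^+ n <= C.
  have B : 1 + n%:R * h <= s^-1 ^+ n.
    elim: n => [|n IH]; first by rewrite mul0r addr0 expr0.
    have -> : s^-1 ^+ n.+1 = (1 + h) * s^-1 ^+ n by rewrite exprS /h addrC subrK.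
    apply: (@le_trans _ _ ((1 + h) * (1 + n%:R * h))).
      rewrite -natr1; have : 0 <= n%:R :> R by []. 
      nra.
    by rewrite ler_pM2l// addr_gt0.
  have sn : 0 < s ^+ n by rewrite exprn_gt0.
  rewrite exprVn in B.
  rewrite -[s ^+ n]invrK ler_pdivrMr ?invr_gt0//.
  apply: (@le_trans _ _ (C * (1 + n%:R * h))); last by rewrite ler_wpM2l// ltW.
  rewrite /C -natr1; have n0 : 0 <= n%:R :> R by [].
  have -> : (1 + h^-1) * (1 + n%:R * h) = 1 + n%:R * h + h^-1 + n%:R.
    by field; rewrite gt_eqF.
  have : 0 <= n%:R * h by rewrite mulr_ge0// ltW.
  have : 0 < h^-1 by rewrite invr_gt0.
  lra.
have g0 : geometric 1 s n @[n --> \oo] --> (0 : R).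
  by apply: cvg_geometric; rewrite ger0_norm// ltW.
have d0 : 0 < e / C by rewrite divr_gt0.
have /cvgrPdist_le/(_ _ d0)[N _ HN] := g0.
have HNn : s ^+ N <= e / C.
  have := HN N (leqnn N); rewrite /geometric /= sub0r normrN mul1r ger0_norm//.
  by rewrite exprn_ge0// ltW.
have main : N.+1%:R * r ^+ N <= e.
  rewrite -sr exprMn mulrA.
  apply: (@le_trans _ _ (C * (e / C))).
    by apply: ler_pM => //; rewrite ?mulr_ge0 ?exprn_ge0// ltW.
  by rewrite mulrCA mulfV ?mulr1// gt_eqF.
exists N; split => //; apply: le_trans main.
have rN : 0 <= r ^+ N by rewrite exprn_ge0.
rewrite exprS ler_wpM2r//; apply: (le_trans (ltW r1)); by rewrite ler1n.
Qed.

(** Taylor polynomials of ln at the right end M of the interval, so that the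
    ratio of the series stays in [0, 1 - delta/M] on [delta, M]. *)
Definition ln_poly (M : R) (n : nat) : {poly R} :=
  (ln M)%:P - \sum_(k < n) k.+1%:R^-1 *: (1 - M^-1 *: 'X) ^+ k.+1.

(** The derivative is a geometric sum; multiplied by X it becomes closed, and
    differentiating this identity also controls the second derivative. *)
Lemma deriv_ln_polyM M n : M != 0 ->
  (ln_poly M n)^`() * 'X = 1 - (1 - M^-1 *: 'X) ^+ n.
Proof.
move=> M0; rewrite /ln_poly; set v := 1 - M^-1 *: 'X.
have dv : v^`() = - M^-1%:P.
  by rewrite /v derivB derivZ derivX derivC sub0r -[1]/(1%:P) -mul_polyC -polyCM mulr1.
have -> : ((ln M)%:P - \sum_(k < n) k.+1%:R^-1 *: v ^+ k.+1)^`() =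
    M^-1%:P * \sum_(k < n) v ^+ k.
  rewrite derivB derivC sub0r (big_morph _ (@derivD R) (deriv0 R)) -sumrN mulr_sumr.
  apply: eq_bigr => k _; rewrite derivZ deriv_exp /= dv.
  by rewrite mulNr mulNrn scalerN opprK -[X in _ *: X]scaler_nat scalerA mulVf ?scale1r// pnatr_eq0.
have -> : 1 - v ^+ n = (1 - v) * \sum_(k < n) v ^+ k.
  by rewrite -[1 in LHS](expr1n _ n) subrXX; congr (_ * _); apply: eq_bigr => k _;
     rewrite expr1n mul1r.
have -> : 1 - v = M^-1%:P * 'X by rewrite /v opprB addrCA subrr addr0 mul_polyC.
by rewrite mulrAC.
Qed.

Lemma ln_poly_approx (d M e : R) : 0 < d -> 0 < e ->
  exists q : {poly R}, forall y, d <= y <= M ->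
  [/\ `|q.[y] - ln y| <= e, `|q^`().[y] - y^-1| <= e
    & `|q^`()^`().[y] - (- y ^- 2)| <= e].
Proof.
move=> d0 e0.
have [Md|dM] := ltP M d.
  by exists 0 => y /andP[h1 h2]; have := le_lt_trans (le_trans h1 h2) Md; rewrite ltxx.
have M0 : 0 < M by exact: lt_le_trans dM.
have Mn0 : M != 0 by rewrite gt_eqF.
pose r := 1 - d / M.
have r01 : 0 <= r < 1.
  by rewrite subr_ge0 ler_pdivrMr// mul1r dM/= ltrBlDr ltrDl divr_gt0.
have /andP[r0 r1] := r01.
(* The three errors turn out to be at most M/d, d^-1 and (M^-1 + d^-1)/d times
   the larger of r^(n+1) and (n+1) r^n. *)
pose C := M / d + d^-1 + (M^-1 + d^-1) / d.
have C0 : 0 < C by rewrite /C !addr_gt0// ?divr_gt0 ?addr_gt0 ?invr_gt0.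
have eC : 0 < e / C by rewrite divr_gt0.
have [n [n1 n2]] := nat_mul_expr_small r01 eC.
set w := e / C in n1 n2 eC; have wC : w * C = e by rewrite divfK// gt_eqF.
pose q := ln_poly M n.+1.
have vE y : (1 - M^-1 *: 'X : {poly R}).[y] = 1 - y / M.
  by rewrite hornerD hornerN hornerZ hornerX -[1]/(1%:P) hornerC mulrC.
have q1E y : q^`().[y] * y = 1 - (1 - y / M) ^+ n.+1.
  have := congr1 (horner^~ y) (deriv_ln_polyM n.+1 Mn0).
  by rewrite hornerM hornerX hornerD hornerN horner_exp vE -polyC1 hornerC.
have q2E y : q^`()^`().[y] * y + q^`().[y] = n.+1%:R / M * (1 - y / M) ^+ n.
  have := congr1 (fun p => p^`().[y]) (deriv_ln_polyM n.+1 Mn0).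
  rewrite derivM derivX mulr1 hornerD hornerM hornerX => ->.
  rewrite !(derivB, deriv_exp, derivZ, derivX) -polyC1 derivC sub0r.
  rewrite hornerN hornerMn hornerM hornerD hornerN hornerZ polyC1.
  by rewrite horner_exp vE /= -polyC1 !hornerC -mulr_natl; ring.
have vr y : d <= y <= M -> 0 <= 1 - y / M <= r.
  move=> /andP[dy yM]; rewrite subr_ge0 ler_pdivrMr// mul1r yM/= /r.
  by rewrite lerD2l lerN2 ler_pM2r ?invr_gt0.
have e1 y : d <= y <= M -> `|q^`().[y] - y^-1| <= w / d.
  move=> dyM; have /andP[dy yM] := dyM; have y0 : 0 < y by exact: lt_le_trans dy.
  have yn0 : y != 0 by rewrite gt_eqF.
  have -> : q^`().[y] - y^-1 = - ((1 - y / M) ^+ n.+1 / y).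
    by apply: (mulIf yn0); rewrite mulrBl q1E mulNr !divfK// mulVf//; ring.
  have /andP[v0 v1] := vr _ dyM.
  rewrite normrN ger0_norm ?divr_ge0 ?exprn_ge0// ?(ltW y0)//.
  apply: ler_pM; rewrite ?invr_ge0 ?(ltW y0) ?exprn_ge0//.
    by apply: le_trans n2; rewrite lerXn2r// nnegrE.
  by rewrite lef_pV2.
have Cp : [/\ 0 < M / d, 0 < d^-1 & 0 < (M^-1 + d^-1) / d].
  by rewrite ?divr_gt0 ?addr_gt0 ?invr_gt0.
case: Cp => Cp1 Cp2 Cp3.
have wle a : a <= C -> w * a <= e by move=> ?; rewrite -wC ler_wpM2l// ltW.
exists q => y dyM; have /andP[dy yM] := dyM; have y0 : 0 < y by exact: lt_le_trans dy.
have yn0 : y != 0 by rewrite gt_eqF.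
split.
- have qM : q.[M] = ln M.
    rewrite /q /ln_poly hornerD hornerN hornerC horner_sum big1 ?subr0// => k _.
    by rewrite hornerZ horner_exp vE divff// subrr expr0n /= mulr0.
  apply: (@le_trans _ _ (w * (M / d))); last by apply: wle; rewrite /C; lra.
  move: yM; rewrite le_eqVlt => /predU1P[->|yM].
    by rewrite qM subrr normr0 mulr_ge0// ltW.
  have der x : x \in `]y, M[ ->
      is_derive x 1 (fun x => q.[x] - ln x) (q^`().[x] - x^-1).
    rewrite in_itv /= => /andP[yx _]; have x0 : 0 < x by exact: lt_trans yx.
    have h1 := is_derive_poly q x; have h2 := is_derive1_ln x0.
    exact: is_deriveB.
  have cts : {within `[y, M], continuous (fun x => q.[x] - ln x)}.
    apply: derivable_within_continuous => x; rewrite in_itv /= => /andP[yx _].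
    have x0 : 0 < x by exact: lt_le_trans yx.
    have h1 := is_derive_poly q x; have h2 := is_derive1_ln x0.
    by apply: derivableB; exact: ex_derive.
  have [c cI] := MVT yM der cts.
  rewrite qM subrr sub0r => /eqP; rewrite eqr_oppLR => /eqP ->.
  rewrite normrN normrM mulrA mulrAC.
  move: cI; rewrite in_itv /= => /andP[yc cM].
  apply: ler_pM => //.
    by apply: e1; rewrite (ltW cM) andbT (le_trans dy)// ltW.
  rewrite gtr0_norm ?subr_gt0// lerBlDr lerDl ltW//.
- apply: (le_trans (e1 _ dyM)); apply: wle; rewrite /C; lra.
- have -> : q^`()^`().[y] - - y ^- 2 =
    (n.+1%:R / M * (1 - y / M) ^+ n - (q^`().[y] - y^-1)) / y.
    by apply: (mulIf yn0); rewrite divfK// -q2E mulrDl; field.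
  rewrite normrM [`|y^-1|]gtr0_norm ?invr_gt0//.
  apply: (@le_trans _ _ (w * ((M^-1 + d^-1) / d))); last by apply: wle; rewrite /C; lra.
  rewrite mulrA; apply: ler_pM => //; rewrite ?invr_ge0 ?(ltW y0)//; last first.
    by rewrite lef_pV2.
  rewrite (le_trans (ler_normB _ _))// mulrDr lerD//; last exact: e1.
  have /andP[v0 v1] := vr _ dyM.
  rewrite ger0_norm; last by rewrite !mulr_ge0 ?exprn_ge0 ?invr_ge0 ?(ltW M0).
  rewrite mulrAC ler_wpM2r ?invr_ge0 ?(ltW M0)//.
  apply: le_trans n1; rewrite ler_wpM2l//.
  by rewrite lerXn2r// nnegrE.
Qed.

End exp_poly.

(** * Log-sum-exp and its jet *)

Section lse_def.
Context {R : realType} {K : finType}.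
Variables (b : R) (P : pred K) (v : K -> R).

Definition softsum : R := \sum_(k | P k) expR (b * v k).
(** A soft maximum for b > 0 and a soft minimum for b < 0. *)
Definition lse : R := b^-1 * ln softsum.
Definition softweight (k : K) : R := expR (b * v k) / softsum.

Lemma softsum_gt0 k0 : P k0 -> 0 < softsum.
Proof.
move=> Pk0; rewrite /softsum (bigD1 k0)//= ltr_pwDl ?expR_gt0//.
by rewrite sumr_ge0// => k _; exact: expR_ge0.
Qed.

Lemma softweight_ge0 k : 0 <= softweight k.
Proof. by rewrite divr_ge0 ?expR_ge0// sumr_ge0// => i _; exact: expR_ge0. Qed.

Lemma sum_softweight k0 : P k0 -> \sum_(k | P k) softweight k = 1.
Proof. by move=> /softsum_gt0 s0; rewrite -mulr_suml mulfV// gt_eqF. Qed.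

End lse_def.

Section jets3.
Context {R : realType} {I : finType}.
Variable A : I -> I -> R.
Hypothesis Asym : forall i j, A i j = A j i.
Notation T := (I -> R).
Notation approx := (@approx R I A).
Notation bil := (@bil R I A).

Lemma approx_sum (K : finType) (P : pred K) (J : K -> T -> jet) :
  (forall k, P k -> approx (J k)) ->
  approx (fun x => Jet (\sum_(k | P k) jv (J k x)) (fun i => \sum_(k | P k) jg (J k x) i)
                       (\sum_(k | P k) jl (J k x))).
Proof.
move=> hJ; rewrite /index_enum; elim: (Finite.enum K) => [|k s IH].
  have := approx_cst A 0; congr approx; apply/funext => x.
  by apply: jetP => [|i|] /=; rewrite big_nil.
have [Pk|nPk] := boolP (P k).
  have := approx_add (hJ k Pk) IH; congr approx; apply/funext => x.
  by apply: jetP => [|i|] /=; rewrite big_cons Pk.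
move: IH; congr approx; apply/funext => x.
by apply: jetP => [|i|] /=; rewrite big_cons (negbTE nPk).
Qed.

Lemma approx_exp f : approx f -> approx (fun x => jcomp A expR expR expR (f x)).
Proof.
move=> hf; have [M HM] := approx_bounded hf.
apply: (approx_comp Asym hf (D := fun y => `|y| <= M)) => [x|e].
  by have [] := HM x.
exact: exp_poly_approx.
Qed.

Lemma approx_ln (d : R) f : 0 < d -> (forall x, d <= jv (f x)) -> approx f ->
  approx (fun x => jcomp A (@ln R) (fun y => y^-1) (fun y => - y ^- 2) (f x)).
Proof.
move=> d0 df hf; have [M HM] := approx_bounded hf.
apply: (approx_comp Asym hf (D := fun y => d <= y <= M)) => [x|e].
  by have [h _ _] := HM x; rewrite df /= (le_trans (ler_norm _)).
exact: ln_poly_approx.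
Qed.

(** Chain rule for b^-1 ln (sum exp (b v)): the gradient is the average under
    the weights p, and the generator picks up b times the variance of the
    gradients under p, measured by the form [bil]. The k0 summand keeps
    the sum of exponentials away from 0, where ln cannot be approximated. *)
Lemma approx_lse (b : R) (K : finType) (P : pred K) (k0 : K) (J : K -> T -> jet) :
  b != 0 -> P k0 -> (forall k, P k -> approx (J k)) ->
  approx (fun x =>
    let p := softweight b P (fun k => jv (J k x)) in
    let g i := \sum_(k | P k) p k * jg (J k x) i in
    Jet (lse b P (fun k => jv (J k x))) g
        (\sum_(k | P k) p k * jl (J k x) +
         b * (\sum_(k | P k) p k * bil (jg (J k x)) (jg (J k x)) - bil g g))).
Proof.
move=> b0 Pk0 hJ.
pose E k x := jcomp A expR expR expR (jscale b (J k x)).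
have hE k : P k -> approx (E k).
  by move=> Pk; apply: approx_exp; apply: approx_scale; exact: hJ.
have hS := approx_sum hE.
have [M HM] := approx_bounded (hJ k0 Pk0).
have := approx_scale b^-1 (approx_ln (expR_gt0 (- (`|b| * M))) _ hS).
move=> /(_ _)/wrap[x|].
  rewrite /= (bigD1 k0)//=; apply: (@le_trans _ _ (expR (b * jv (J k0 x)))).
    rewrite ler_expR; have [h _ _] := HM x.
    have : `|b * jv (J k0 x)| <= `|b| * M by rewrite normrM ler_wpM2l.
    by rewrite ler_norml => /andP[].
  by rewrite lerDl sumr_ge0// => k _; exact: expR_ge0.
congr approx; apply/funext => x.
set S := softsum b P (fun k => jv (J k x)).
have S0 : S != 0 by rewrite gt_eqF// (softsum_gt0 _ _ Pk0).
have gE : (fun i => \sum_(k | P k) expR (b * jv (J k x)) * (b * jg (J k x) i)) =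
   (fun i => b * S * (\sum_(k | P k) softweight b P (fun k => jv (J k x)) k * jg (J k x) i)).
  apply/funext => i; rewrite mulr_sumr; apply: eq_bigr => k _.
  by rewrite /softweight -/S; field.
apply: jetP => [|i|] /=.
- by [].
- rewrite -[\sum_(k | P k) expR (b * jv (J k x))]/S (congr1 (fun f => f i) gE); field.
  by rewrite b0 S0.
- rewrite gE -[\sum_(k | P k) expR (b * jv (J k x))]/S (bilZl A) (bilZr Asym).
  set B := bil _ _.
  have -> : \sum_(k | P k) (expR (b * jv (J k x)) * (b * jl (J k x)) +
      expR (b * jv (J k x)) * bil (fun i => b * jg (J k x) i) (fun i => b * jg (J k x) i)) =
    b * S * (\sum_(k | P k) softweight b P (fun k => jv (J k x)) k * jl (J k x) +
      b * \sum_(k | P k) softweight b P (fun k => jv (J k x)) k * bil (jg (J k x)) (jg (J k x))).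
    rewrite big_split /= mulrDr; congr (_ + _).
      rewrite mulr_sumr; apply: eq_bigr => k _.
      by rewrite /softweight -/S; field.
    rewrite mulrA mulr_sumr; apply: eq_bigr => k _.
    by rewrite (bilZl A) (bilZr Asym) /softweight -/S; field.
  by field; rewrite b0 S0.
Qed.

End jets3.

(** * Order statistics as a minimum of maxima, and their smoothing *)

Section lse_bounds.
Context {R : realType} {K : finType}.
Variables (b : R) (P : pred K) (v : K -> R).

Lemma lse_ge k : 0 < b -> P k -> v k <= lse b P v.
Proof.
move=> b0 Pk; rewrite /lse mulrC ler_pdivlMr// mulrC.
rewrite -[leLHS]expRK ler_ln ?posrE ?expR_gt0 ?(softsum_gt0 _ _ Pk)//.
by rewrite /softsum (bigD1 k)//= lerDl sumr_ge0// => i _; exact: expR_ge0.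
Qed.

Lemma lse_le k M : 0 < b -> P k -> (forall k, P k -> v k <= M) ->
  lse b P v <= M + ln #|P|%:R / b.
Proof.
move=> b0 Pk vM; rewrite /lse mulrC ler_pdivrMr// mulrDl divfK ?gt_eqF//.
have P0 : 0 < #|P|%:R :> R by rewrite ltr0n; apply/card_gt0P; exists k.
have -> : M * b + ln #|P|%:R = ln (expR (b * M) * #|P|%:R).
  by rewrite lnM ?posrE ?expR_gt0// expRK mulrC.
rewrite ler_ln ?posrE ?mulr_gt0 ?expR_gt0 ?(softsum_gt0 _ _ Pk)//.
rewrite mulr_natr -sumr_const; apply: ler_sum => i Pi.
by rewrite ler_expR ler_pM2l// vM.
Qed.

End lse_bounds.

Lemma lseN {R : realType} {K : finType} (b : R) (P : pred K) (v : K -> R) :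
  lse (- b) P v = - lse b P (fun k => - v k).
Proof.
rewrite /lse invrN mulNr; congr (- (_ * ln _)).
by apply: eq_bigr => k _; rewrite mulrN mulNr.
Qed.

Section softmin_bounds.
Context {R : realType} {K : finType}.
Variables (b : R) (P : pred K) (v : K -> R).

Lemma softmin_le k : 0 < b -> P k -> lse (- b) P v <= v k.
Proof.
by move=> b0 Pk; rewrite lseN lerNl; exact: (lse_ge (fun k => - v k) b0 Pk).
Qed.

Lemma softmin_ge k m : 0 < b -> P k -> (forall k, P k -> m <= v k) ->
  m - ln #|P|%:R / b <= lse (- b) P v.
Proof.
move=> b0 Pk vm; rewrite lseN lerNr opprB addrC.
by apply: (lse_le b0 Pk) => i Pi; rewrite lerN2 vm.
Qed.

End softmin_bounds.

Section order_statistic.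
Context {R : realType} {d : nat}.
Variable h : nat.
Hypotheses (h_gt0 : (1 <= h)%N) (h_le_d : (h <= d)%N).
Implicit Types z : 'I_d -> R.

Let sorted_vals z := sort <=%R [seq z i | i <- enum 'I_d].

Let size_sv z : size (sorted_vals z) = d.
Proof. by rewrite size_sort size_map size_enum_ord. Qed.

Let nth_sv z i j : (i <= j < d)%N ->
  nth 0 (sorted_vals z) i <= nth 0 (sorted_vals z) j.
Proof.
move=> /andP[ij jd]; apply: (sorted_leq_nth le_trans le_refl) => //.
- by apply: sort_sorted; exact: le_total.
- by rewrite inE size_sv (leq_ltn_trans ij).
- by rewrite inE size_sv.
Qed.

Let card_sv z (p : pred R) : #|[set i | p (z i)]%SET| = count p (sorted_vals z).
Proof.
rewrite /sorted_vals; have /permP -> : perm_eq (sort <=%R [seq z i | i <- enum 'I_d]) [seq z i | i <- enum 'I_d].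
  exact: permEl (perm_sort _ _).
rewrite count_map -size_filter cardE; congr size.
by rewrite enumT /enum_mem; apply: eq_filter => i; rewrite /= inE.
Qed.

Let h1d : (h.-1 < d)%N. Proof. by rewrite prednK. Qed.

Lemma order_stat_card_le z : (h <= #|[set i | (z i <= order_stat z h)%R]%SET|)%N.
Proof.
rewrite (card_sv z (fun x => x <= order_stat z h)).
rewrite -[sorted_vals z](cat_take_drop h) count_cat.
have sz : size (take h (sorted_vals z)) = h by rewrite size_takel// size_sv.
rewrite -[X in (X <= _)%N]sz; apply: leq_trans (leq_addr _ _).
rewrite -size_filter leq_eqVlt; apply/orP; left; apply/eqP; congr size.
apply/esym/all_filterP/(all_nthP 0) => i; rewrite sz => ih.
rewrite nth_take// /order_stat; apply: nth_sv.
by rewrite h1d andbT -ltnS prednK.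
Qed.

Lemma order_stat_card_lt z : (#|[set i | (z i < order_stat z h)%R]%SET| < h)%N.
Proof.
rewrite (card_sv z (fun x => x < order_stat z h)).
rewrite -[sorted_vals z](cat_take_drop h.-1) count_cat.
have -> : count (fun x => x < order_stat z h) (drop h.-1 (sorted_vals z)) = 0%N.
  apply/eqP; rewrite -leqn0 leqNgt -has_count; apply/hasPn => x.
  move=> /(nthP 0)[i]; rewrite size_drop size_sv => id <-.
  rewrite nth_drop -leNgt /order_stat; apply: nth_sv.
  by rewrite leq_addr -ltn_subRL.
rewrite addn0 (leq_ltn_trans (count_size _ _))//.
by rewrite size_takel ?size_sv ?(ltnW h1d)// prednK.
Qed.

(** The h-th smallest coordinate is the minimum over h-subsets of the maximum
    over the subset; this lemma and the next are the two halves of that identity,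
    and everything else about order statistics follows from them. *)
Lemma order_stat_ge_subset z :
  exists2 S : {set 'I_d}, #|S| == h & forall i, i \in S -> z i <= order_stat z h.
Proof.
set B := [set i | z i <= order_stat z h]%SET.
have : (0 < #|[set S : {set 'I_d} | S \subset B & #|S| == h]%SET|)%N.
  by rewrite cards_draws bin_gt0 order_stat_card_le.
move=> /card_gt0P[S]; rewrite inE => /andP[SB Sh]; exists S => // i iS.
by have := fintype.subsetP SB _ iS; rewrite inE.
Qed.

Lemma order_stat_le_subset z (S : {set 'I_d}) : #|S| == h ->
  exists2 i, i \in S & order_stat z h <= z i.
Proof.
move=> /eqP Sh; apply/exists_inP; rewrite -[X in is_true X]negbK; apply/negP.
rewrite negb_exists_in => /forall_inP all_lt.
have := order_stat_card_lt z; rewrite ltnNge -{1}Sh => /negP; apply.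
apply: subset_leq_card; apply/fintype.subsetP => i /all_lt.
by rewrite -ltNge inE.
Qed.

Lemma order_stat_leD z z' e : (forall i, z i <= z' i + e) ->
  order_stat z h <= order_stat z' h + e.
Proof.
move=> zz'; have [S Sh HS] := order_stat_ge_subset z'.
have [i iS Hi] := order_stat_le_subset z Sh.
by apply: (le_trans Hi); apply: (le_trans (zz' i)); rewrite lerD2r HS.
Qed.

Lemma order_stat_norm_le z : `|order_stat z h| <= \sum_i `|z i|.
Proof.
have [S Sh HS] := order_stat_ge_subset z.
have [i iS Hi] := order_stat_le_subset z Sh.
have -> : order_stat z h = z i by apply/eqP; rewrite eq_le Hi HS.
by rewrite (bigD1 i)//= lerDl sumr_ge0.
Qed.

(** Soft minimum, at inverse temperature a, of soft maxima at inverse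
    temperature b. *)
Definition soft_order_stat (a b : R) z : R :=
  lse (- a) (fun S : {set 'I_d} => #|S| == h) (fun S => lse b (mem S) z).

Lemma soft_order_stat_le a b z : 0 < a -> 0 < b ->
  soft_order_stat a b z <= order_stat z h + ln h%:R / b.
Proof.
move=> a0 b0; have [S Sh HS] := order_stat_ge_subset z.
apply: (le_trans (softmin_le _ a0 Sh)).
have /card_gt0P[k kS] : (0 < #|S|)%N by rewrite (eqP Sh).
by have := lse_le b0 kS HS; rewrite (eqP Sh).
Qed.

Lemma soft_order_stat_ge a b z : 0 < a -> 0 < b ->
  order_stat z h - ln 'C(d, h)%:R / a <= soft_order_stat a b z.
Proof.
move=> a0 b0; have [S Sh _] := order_stat_ge_subset z.
have := @softmin_ge _ _ a (fun S : {set 'I_d} => #|S| == h)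
  (fun S => lse b (mem S) z) S (order_stat z h) a0 Sh.
have -> : #|(fun S : {set 'I_d} => #|S| == h)| = 'C(d, h).
  by have := card_draws 'I_d h; rewrite cardsE card_ord.
apply => S' S'h; have [i iS Hi] := order_stat_le_subset z S'h.
exact: le_trans Hi (lse_ge _ b0 iS).
Qed.

(** A pointwise limit of the smoothed statistics, which are built from exp, ln
    and finite sums. *)
Lemma measurable_order_stat (dT : measure_display) (T : measurableType dT)
    (X : 'I_d -> T -> R) : (forall i, measurable_fun setT (X i)) ->
  measurable_fun setT (fun w => order_stat (fun i => X i w) h).
Proof.
move=> mX.
have mlse b (K : finType) (P : pred K) (Y : K -> T -> R) :
    (forall k, measurable_fun setT (Y k)) ->
    measurable_fun setT (fun w => lse b P (fun k => Y k w)).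
  move=> mY; apply: measurable_funM => //; apply: measurableT_comp => //.
  rewrite /softsum; under eq_fun do rewrite big_mkcond/=.
  apply: measurable_sum => k; case: (P k) => //.
  by apply: measurableT_comp => //; exact: measurable_funM.
pose f n w := soft_order_stat n.+1%:R n.+1%:R (fun i => X i w).
apply: (@measurable_fun_cvg _ _ _ _ f) => [n|w _].
  by apply: (mlse _ _ _ _ _) => S; exact: mlse.
pose z i := X i w; pose C := ln 'C(d, h)%:R + ln h%:R : R.
have lnge0 n : (0 < n)%N -> 0 <= ln n%:R :> R by move=> n0; rewrite ln_ge0// ler1n.
have C1 := lnge0 _ h_gt0; have C2 : 0 <= ln 'C(d, h)%:R :> R.
  by rewrite lnge0// bin_gt0.
have l0 : (fun n => C * n.+1%:R^-1) @ \oo --> (0 : R).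
  rewrite -[X in _ --> X](mulr0 C); apply: cvgM; first exact: cvg_cst.
  exact: cvg_harmonic.
apply/subr_cvg0; apply: norm_cvg0; apply: (@squeeze_cvgr _ _ _ _ (cst 0) _ _ _ _ _ l0).
  apply: nearW => n; rewrite /= normr_ge0/= ler_norml.
  have n0 : 0 < n.+1%:R :> R by [].
  have := soft_order_stat_le z n0 n0; have := soft_order_stat_ge z n0 n0.
  rewrite -/(f n w) -/z /C mulrDl.
  have : 0 <= ln h%:R / n.+1%:R :> R by rewrite divr_ge0.
  have : 0 <= ln 'C(d, h)%:R / n.+1%:R :> R by rewrite divr_ge0.
  rewrite /f -/z; set p := ln 'C(d, h)%:R / _; set q := ln h%:R / _.
  set F := soft_order_stat _ _ _; move=> h1 h2 h3 h4.
  by clearbody F p q; apply/andP; split; lra.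
exact: cvg_cst.
Qed.

End order_statistic.

(** * The generator of the smoothed order statistic *)

Section variance_form.
Context {R : realType} {I : finType}.
Variable a : I -> I -> R.

(** The variance of a quadratic form under probability weights only depends on
    the increments a_ii + a_jj - 2 a_ij. *)
Lemma var_bilE (p : I -> R) : \sum_i p i = 1 ->
  \sum_i p i * (2^-1 * a i i) - bil a p p =
  4^-1 * \sum_i \sum_j p i * p j * (a i i + a j j - 2 * a i j).
Proof.
move=> p1.
have e1 : \sum_i \sum_j p i * p j * (a i i) = \sum_i p i * a i i.
  apply: eq_bigr => i _; rewrite -mulr_suml -mulr_sumr p1; ring.
have e2 : \sum_i \sum_j p i * p j * (a j j) = \sum_i p i * a i i.
  rewrite exchange_big; apply: eq_bigr => i _ /=.
  by rewrite -mulr_suml -mulr_suml p1; ring.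
have -> : \sum_i \sum_j p i * p j * (a i i + a j j - 2 * a i j) =
  \sum_i \sum_j p i * p j * a i i + \sum_i \sum_j p i * p j * a j j
  - 2 * \sum_i \sum_j a i j * (p i * p j).
  rewrite mulr_sumr -sumrN -!big_split /=; apply: eq_bigr => i _.
  rewrite mulr_sumr -sumrN -!big_split /=; apply: eq_bigr => j _.
  ring.
rewrite e1 e2 /bil.
have -> : \sum_i p i * (2^-1 * a i i) = 2^-1 * \sum_i p i * a i i.
  by rewrite mulr_sumr; apply: eq_bigr => i _; ring.
by field.
Qed.

Variable g : R.
Hypothesis a_incr : forall i j, `|a i i + a j j - 2 * a i j| <= g.

Lemma var_bil_le (p : I -> R) : (forall i, 0 <= p i) -> \sum_i p i = 1 ->
  `|\sum_i p i * (2^-1 * a i i) - bil a p p| <= g / 4.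
Proof.
move=> p0 p1; rewrite var_bilE// normrM gtr0_norm// mulrC ler_pM2r//.
have -> : g = \sum_i \sum_j p i * p j * g.
  rewrite -[LHS]mul1r -[1](mulr1 1) -{1}p1 -mulrA mulr_suml; apply: eq_bigr => i _.
  by rewrite -mulr_suml -mulr_sumr p1; ring.
rewrite (le_trans (ler_norm_sum _ _ _))//; apply: ler_sum => i _.
rewrite (le_trans (ler_norm_sum _ _ _))//; apply: ler_sum => j _.
by rewrite normrM ger0_norm ?mulr_ge0// ler_wpM2l// mulr_ge0.
Qed.

(** The variance of a mixture of the p k minus the mean of their variances:
    both lie within g/4 of 0 by [var_bil_le]. *)
Lemma mix_bil_le (K : finType) (P : pred K) (q : K -> R) (p : K -> I -> R) :
  (forall k, 0 <= q k) -> \sum_(k | P k) q k = 1 ->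
  (forall k i, 0 <= p k i) -> (forall k, P k -> \sum_i p k i = 1) ->
  `|\sum_(k | P k) q k * bil a (p k) (p k) -
    bil a (fun i => \sum_(k | P k) q k * p k i) (fun i => \sum_(k | P k) q k * p k i)|
  <= g / 2.
Proof.
move=> q0 q1 p0 p1; pose m i := \sum_(k | P k) q k * p k i; rewrite -/m.
have m0 i : 0 <= m i by rewrite sumr_ge0// => k _; rewrite mulr_ge0.
have m1 : \sum_i m i = 1.
  rewrite exchange_big /= -q1; apply: eq_bigr => k Pk.
  by rewrite -mulr_sumr p1// mulr1.
pose V u := \sum_i u i * (2^-1 * a i i) - bil a u u.
have lin : \sum_i m i * (2^-1 * a i i) =
    \sum_(k | P k) q k * \sum_i p k i * (2^-1 * a i i).
  under eq_bigr do rewrite mulr_suml.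
  rewrite exchange_big /=; apply: eq_bigr => k _; rewrite mulr_sumr.
  by apply: eq_bigr => i _; rewrite mulrA.
have -> : \sum_(k | P k) q k * bil a (p k) (p k) - bil a m m =
    V m - \sum_(k | P k) q k * V (p k).
  have -> : \sum_(k | P k) q k * V (p k) =
     \sum_(k | P k) q k * (\sum_i p k i * (2^-1 * a i i)) -
     \sum_(k | P k) q k * bil a (p k) (p k).
    by rewrite -sumrB; apply: eq_bigr => k _; rewrite mulrBr.
  by rewrite /V lin; ring.
rewrite (le_trans (ler_normB _ _))//.
have -> : g / 2 = g / 4 + g / 4 by field.
apply: lerD; first exact: var_bil_le.
rewrite (le_trans (ler_norm_sum _ _ _))//.
have -> : g / 4 = (\sum_(k | P k) q k) * (g / 4) by rewrite q1 mul1r.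
rewrite mulr_suml; apply: ler_sum => k Pk.
rewrite normrM ger0_norm//; apply: ler_wpM2l => //; apply: (var_bil_le (p0 k)).
exact: p1.
Qed.

End variance_form.

Section trig_bounds.
Context {R : realType}.

Lemma cos_near1 (u : R) : `|1 - cos u| <= `|u|.
Proof.
wlog u0 : u / 0 <= u.
  move=> H; have [/H//|/ltW u0] := leP 0 u.
  by have := H (- u); rewrite cosN normrN oppr_ge0; exact.
move: u0; rewrite le_eqVlt => /predU1P[<-|u0]; first by rewrite cos0 subrr.
have [|c _] := @MVT R cos (fun x => - sin x) 0 u u0 (fun x _ => is_derive_cos x).
  by apply: derivable_within_continuous => x _; exact: ex_derive.
rewrite cos0 subr0 distrC => ->; rewrite normrM normrN.
by rewrite ler_piMl// sin_max.
Qed.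

Lemma sin_near_id (u : R) : `|sin u - u| <= u ^+ 2.
Proof.
wlog u0 : u / 0 <= u.
  move=> H; have [/H//|/ltW u0] := leP 0 u.
  by have := H (- u); rewrite sinN -opprD normrN sqrrN oppr_ge0; exact.
move: u0; rewrite le_eqVlt => /predU1P[<-|u0].
  by rewrite sin0 subrr normr0 expr0n.
have der x : is_derive x (1 : R) (fun x => sin x - x) (cos x - 1).
  by have := is_derive_sin x => ?; apply: is_derive_eq.
have [|c cI] := @MVT R (fun x => sin x - x) (fun x => cos x - 1) 0 u u0 (fun x _ => der x).
  by apply: derivable_within_continuous => x _; have := der x => ?; exact: ex_derive.
rewrite sin0 !subr0 => ->; rewrite normrM expr2 (gtr0_norm u0) ler_pM2r//.
rewrite distrC (le_trans (cos_near1 c))//.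
by move: cI; rewrite in_itv /= => /andP[c0 cu]; rewrite gtr0_norm// ltW.
Qed.

End trig_bounds.

Section soft_jet.
Context {R : realType} {d : nat}.
Notation I := 'I_d.
Variables (A : I -> I -> R) (g L : R).
Hypothesis Asym : forall i j, A i j = A j i.
Hypothesis A_incr : forall i j, `|A i i + A j j - 2 * A i j| <= g.
Hypothesis L0 : 0 < L.
Notation T := (I -> R).

(** The jet of L sin(x_i / L), which truncates the coordinate x_i smoothly. *)
Definition sinjet (i : I) (x : T) : @jet R I :=
  Jet (L * sin (x i / L)) (fun j => (j == i)%:R * cos (x i / L))
      (- (A i i * sin (x i / L) / (2 * L))).

Lemma bil_delta (i : I) k : bil A (fun j => (j == i)%:R * k) (fun j => (j == i)%:R * k) =
  2^-1 * A i i * k ^+ 2.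
Proof.
rewrite /bil (bigD1 i)//= (bigD1 i)//= eqxx big1 => [|j ji]; last first.
  by rewrite (negbTE ji) mul0r !mulr0.
rewrite big1 => [|j ji]; first by rewrite !addr0 !mul1r expr2 !mulrA.
by rewrite big1// => l _; rewrite (negbTE ji) mul0r mul0r mulr0.
Qed.

(** sin u = cos(u - pi/2). *)
Lemma approx_sinjet i : approx A (sinjet i).
Proof.
have Ln0 : L != 0 by rewrite gt_eqF.
have := approx_scale L (approx_trig (trig_cos A (fun j => (j == i)%:R * L^-1) (- (pi / 2)))).
congr approx; apply/funext => x; rewrite /cosjet /sinjet bil_delta.
have -> : \sum_j (j == i)%:R * L^-1 * x j = x i / L.
  rewrite (bigD1 i)//= eqxx big1 => [|j ji]; last by rewrite (negbTE ji) !mul0r.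
  by rewrite mul1r addr0 mulrC.
have e1 : cos (x i / L - pi / 2) = sin (x i / L).
  by rewrite cosB cos_pihalf sin_pihalf; ring.
have e2 : sin (x i / L - pi / 2) = - cos (x i / L).
  by rewrite sinB cos_pihalf sin_pihalf; ring.
by apply: jetP => [|j|] /=; rewrite ?e1 ?e2//; field.
Qed.

(** The factors c_i = cos(x_i / L) brought in by the truncation are moved from the
    gradients to the matrix, so that the variance bounds apply with weights that
    still sum to 1. *)
Lemma bil_diag c (u w : T) : bil A (fun i => u i * c i) (fun i => w i * c i) =
  bil (fun i j => A i j * c i * c j) u w.
Proof.
by rewrite /bil; congr (_ * _); apply: eq_bigr => i _; apply: eq_bigr => j _; ring.
Qed.

Variables (h : nat) (a b : R).
Hypotheses (h_gt0 : (1 <= h)%N) (h_le_d : (h <= d)%N) (a0 : 0 < a) (b0 : 0 < b).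

(** The inner log-sum-exp contributes b times a variance and the outer one a times
    a mixture variance, bounded by g/4 and g/2 for the untruncated matrix.
    Truncation moves the increments of the matrix by a multiple of |x|/L, and
    the second derivative of L sin(x_i/L) is of order 1/L. *)
Lemma soft_jet : exists2 F : T -> jet, approx A F & forall x,
  jv (F x) = soft_order_stat h a b (fun i => L * sin (x i / L)) /\
  `|jl (F x)| <= (g + 8 * (\sum_i \sum_j `|A i j|) * ((\sum_i `|x i|) / L)) *
     (b / 4 + a / 2) + (\sum_i \sum_j `|A i j|) / L.
Proof.
set N := \sum_i \sum_j _.
pose PS (S : {set I}) := #|S| == h.
have S0 S : PS S -> exists i, i \in S.
  by move=> /eqP Sh; apply/card_gt0P; rewrite Sh.
have [S1 PS1] : exists S, PS S.
  have [S Sh _] := order_stat_ge_subset h_gt0 h_le_d (fun=> 0 : R).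
  by exists S.
pose inner (S : {set I}) x :=
  let p := softweight b (mem S) (fun k => jv (sinjet k x)) in
  let gr j := \sum_(k | mem S k) p k * jg (sinjet k x) j in
  Jet (lse b (mem S) (fun k => jv (sinjet k x))) gr
     (\sum_(k | mem S k) p k * jl (sinjet k x) +
      b * (\sum_(k | mem S k) p k * bil A (jg (sinjet k x)) (jg (sinjet k x)) - bil A gr gr)).
have h_inner S : PS S -> approx A (inner S).
  move=> /S0[i iS]; apply: (approx_lse Asym (k0 := i)) => //.
    by rewrite gt_eqF.
  by move=> k _; exact: approx_sinjet.
have an0 : - a != 0 by rewrite oppr_eq0 gt_eqF.
have hF := approx_lse Asym an0 PS1 h_inner.
eexists; first exact: hF.
move=> x; split; first by [].
rewrite /=.
set q := softweight (- a) _ _.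
pose w (S : {set I}) := softweight b (mem S) (fun k => L * sin (x k / L)).
pose c i := cos (x i / L).
pose p (S : {set I}) i := if i \in S then w S i else 0.
have q0 S : 0 <= q S by exact: softweight_ge0.
have q1 : \sum_(S | PS S) q S = 1 by exact: sum_softweight PS1.
have p0 (S : {set I}) i : 0 <= p S i by rewrite /p; case: ifP => // _; exact: softweight_ge0.
have p1 S : PS S -> \sum_i p S i = 1.
  by move=> /S0[i iS]; rewrite /p -big_mkcond /=; apply: (sum_softweight _ _ iS).
have gradE (S : {set I}) : (fun j => \sum_(k | mem S k) w S k * jg (sinjet k x) j) =
    (fun j => p S j * c j).
  apply/funext => j; rewrite /= big_mkcond (bigD1 j)//= eqxx big1 => [|i ij].
    by rewrite /p addr0 mul1r /c; case: ifP => _; rewrite ?mul0r.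
  by rewrite eq_sym (negbTE ij) mul0r mulr0; case: ifP.
pose m i := \sum_(S | PS S) q S * p S i.
have gradE2 : (fun i => \sum_(S | PS S) q S *
     (\sum_(k | mem S k) w S k * jg (sinjet k x) i)) = (fun i => m i * c i).
  apply/funext => i; rewrite /m mulr_suml; apply: eq_bigr => S _.
  by rewrite (congr1 (fun f => f i) (gradE S)) mulrA.
pose Ac i j := A i j * c i * c j.
pose X := \sum_i `|x i|.
have X0 : 0 <= X by rewrite sumr_ge0.
have N0 : 0 <= N by do 2 apply: sumr_ge0 => ? _.
have AN i j : `|A i j| <= N.
  rewrite /N (bigD1 i)//= (bigD1 j)//= -addrA lerDl addr_ge0//.
    by rewrite sumr_ge0.
  by do 2 apply: sumr_ge0 => ? _.
have XL0 : 0 <= X / L by rewrite divr_ge0// ltW.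
have cX i : `|1 - c i| <= X / L.
  rewrite (le_trans (cos_near1 _))// normrM [`|L^-1|]gtr0_norm ?invr_gt0//.
  rewrite ler_pM2r ?invr_gt0// /X (bigD1 i)//= lerDl sumr_ge0//.
have cc i j : `|A i j * (1 - c i * c j)| <= 2 * N * (X / L).
  have -> : 2 * N * (X / L) = N * (X / L + X / L) by ring.
  rewrite normrM ler_pM//.
  have -> : 1 - c i * c j = (1 - c i) + c i * (1 - c j) by ring.
  rewrite (le_trans (ler_normD _ _))// lerD//.
  rewrite normrM; apply: le_trans (cX j); rewrite ler_piMl//.
  exact: cos_max.
pose g' := g + 8 * N * (X / L).
have Ac_incr i j : `|Ac i i + Ac j j - 2 * Ac i j| <= g'.
  have -> : Ac i i + Ac j j - 2 * Ac i j = (A i i + A j j - 2 * A i j) -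
    A i i * (1 - c i * c i) - A j j * (1 - c j * c j) + 2 * (A i j * (1 - c i * c j)).
    by rewrite /Ac; ring.
  rewrite /g'; have := A_incr i j; have := cc i i; have := cc j j; have := cc i j.
  rewrite !ler_norml => /andP[? ?] /andP[? ?] /andP[? ?] /andP[? ?].
  by apply/andP; split; lra.
have innerE S : PS S -> jl (inner S x) =
    \sum_i p S i * jl (sinjet i x) +
    b * (\sum_i p S i * (2^-1 * Ac i i) - bil Ac (p S) (p S)).
  move=> PSS; rewrite /= -/(w S) gradE bil_diag -/Ac.
  congr (_ + b * (_ - _)).
    rewrite [LHS]big_mkcond; apply: eq_bigr => i _; rewrite /p; case: ifP => //= _.
    by rewrite mul0r.
  rewrite [LHS]big_mkcond; apply: eq_bigr => i _; rewrite /p; case: ifP => /= _.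
    by rewrite bil_delta /Ac /c; ring.
  by rewrite mul0r.
rewrite -/PS.
have -> : bil A (fun i => \sum_(k | PS k) q k *
     (\sum_(k0 | mem k k0) w k k0 * jg (sinjet k0 x) i))
   (fun i => \sum_(k | PS k) q k *
     (\sum_(k0 | mem k k0) w k k0 * jg (sinjet k0 x) i)) = bil Ac m m.
  by rewrite gradE2 bil_diag.
have -> : \sum_(k | PS k) q k * bil A (jg (inner k x)) (jg (inner k x)) =
   \sum_(k | PS k) q k * bil Ac (p k) (p k).
  by apply: eq_bigr => S _; rewrite [jg _]gradE bil_diag.
have mix := mix_bil_le Ac_incr q0 q1 p0 p1.
have inner_le S : PS S -> `|jl (inner S x)| <= N / L + b * (g' / 4).
  move=> PSS; rewrite innerE// (le_trans (ler_normD _ _))// lerD//.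
    rewrite (le_trans (ler_norm_sum _ _ _))//.
    have -> : N / L = (\sum_i p S i) * (N / L) by rewrite p1// mul1r.
    rewrite mulr_suml; apply: ler_sum => i _.
    rewrite normrM ger0_norm// ler_wpM2l//= normrN !normrM.
    rewrite [`|(2 * L)^-1|]gtr0_norm ?invr_gt0 ?mulr_gt0//.
    rewrite -[leRHS]mulr1 -!mulrA ler_pM//; first by rewrite mulr_ge0// invr_ge0 mulr_ge0// ltW.
    rewrite mulr1 invfM mulrA ler_piMl ?invr_ge0 ?(ltW L0)//.
    have := sin_max (x i / L); have : 0 <= `|sin (x i / L)| by []. 
    lra.
  by rewrite normrM gtr0_norm// ler_pM2l// var_bil_le// p1.
rewrite (le_trans (ler_normD _ _))//.
have -> : (g + 8 * N * (X / L)) * (b / 4 + a / 2) + N / L =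
   (N / L + b * (g' / 4)) + a * (g' / 2) by rewrite /g'; ring.
apply: lerD; last first.
  by rewrite normrM normrN (gtr0_norm a0) ler_pM2l.
rewrite (le_trans (ler_norm_sum _ _ _))//.
set E := N / L + _; have -> : E = (\sum_(S | PS S) q S) * E by rewrite q1 mul1r.
rewrite mulr_suml; apply: ler_sum => S PSS.
by rewrite normrM ger0_norm// ler_wpM2l// inner_le.
Qed.

End soft_jet.

(** * Interpolation between two Gaussian vectors *)

Section product_expectation.
Context {R : realType} (dT : measure_display) (T : measurableType dT)
  (dU : measure_display) (U : measurableType dU).
Variables (P : probability T R) (Q : probability U R).

Definition prodP : probability (T * U)%type R := (P \x Q)%E.

Lemma integ_fst f : integ P f -> integ prodP (fun z => f z.1).
Proof.
move=> hf; have mf : measurable_fun setT (fun z : T * U => f z.1).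
  by apply: measurableT_comp => //; exact: integ_measurable hf.
apply/integrable12ltyP; first exact/measurable_EFinP.
have /integrableP[_] := hf; apply: le_lt_trans; rewrite le_eqVlt; apply/orP; left.
apply/eqP/eq_integral => w _ /=.
by rewrite integral_cst// -[RHS]mule1; congr (_ * _)%E; exact: probability_setT.
Qed.

Lemma integ_snd f : integ Q f -> integ prodP (fun z => f z.2).
Proof.
move=> hf; have mf : measurable_fun setT (fun z : T * U => f z.2).
  by apply: measurableT_comp => //; exact: integ_measurable hf.
apply/integrable21ltyP; first exact/measurable_EFinP.
have /integrableP[_] := hf; apply: le_lt_trans; rewrite le_eqVlt; apply/orP; left.
apply/eqP/eq_integral => w _ /=.
by rewrite integral_cst// -[RHS]mule1; congr (_ * _)%E; exact: probability_setT.
Qed.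

Lemma expect_prod f : integ prodP f -> (forall w, integ Q (fun u => f (w, u))) ->
  \int[prodP]_z f z = \int[P]_w \int[Q]_u f (w, u).
Proof.
move=> hf hfw; rewrite /Rintegral -(integral12_prod_meas1 hf); congr fine.
apply: eq_integral => w _ /=; rewrite fineK//; apply: integrable_fin_num => //.
exact: hfw.
Qed.

Lemma expect_fst f : integ P f -> \int[prodP]_z f z.1 = \int[P]_w f w.
Proof.
move=> hf; rewrite expect_prod; [|exact: integ_fst|by move=> w; exact: (integ_cst Q (f w))].
by apply: eq_Rintegral => w _; exact: (expect_cst Q (f w)).
Qed.

Lemma expect_snd f : integ Q f -> \int[prodP]_z f z.2 = \int[Q]_w f w.
Proof.
by move=> hf; rewrite expect_prod; [exact: (expect_cst P (\int[Q]_u f u))|exact: integ_snd|].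
Qed.

End product_expectation.

Section interpolation.
Context {R : realType} (dT : measure_display) (T : measurableType dT)
  (dU : measure_display) (U : measurableType dU).
Variables (P : probability T R) (Q : probability U R) (d : nat).
Variables (W : 'I_d -> {RV P >-> R}) (Z : 'I_d -> {RV Q >-> R}).
Hypotheses (gaussW : gaussian_vector W) (gaussZ : gaussian_vector Z).
Hypothesis eq_mean : forall i, vmean W i = vmean Z i.
Notation I := 'I_d.
Notation PQ := (prodP P Q).

Definition cov_gap (i j : I) : R := vcov W i j - vcov Z i j.
Notation trig := (@trig R I cov_gap).

(** Living on the product space, the two summands are independent. The square
    roots make the covariance affine in t: t Cov(W) + (1 - t) Cov(Z). *)
Definition interp (t : R) (z : T * U) (i : I) : R :=
  vmean W i + Num.sqrt t * (W i z.1 - vmean W i)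
            + Num.sqrt (1 - t) * (Z i z.2 - vmean Z i).

Lemma measurable_interp t i : measurable_fun setT (fun z => interp t z i).
Proof.
apply: measurable_funD; first apply: measurable_funD => //.
  apply: measurable_funM => //; apply: measurable_funB => //.
  exact: measurableT_comp.
apply: measurable_funM => //; apply: measurable_funB => //.
exact: measurableT_comp.
Qed.

Lemma measurable_trig (dX : measure_display) (X : measurableType dX)
    (Y : X -> I -> R) p : (forall i, measurable_fun setT (fun z => Y z i)) ->
  trig p -> measurable_fun setT (fun z => jv (p (Y z))) /\
            measurable_fun setT (fun z => jl (p (Y z))).
Proof.
move=> mY; have mcos : measurable_fun setT (@cos R).
  by apply: continuous_measurable_fun; exact: continuous_cos.
elim=> [a c|{}p q _ [hp1 hp2] _ [hq1 hq2]|k {}p _ [hp1 hp2]] /=.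
- have mu_ : measurable_fun setT (fun z => cos (\sum_i a i * Y z i + c)).
    apply: measurableT_comp => //; apply: measurable_funD => //.
    by apply: measurable_sum => i; exact: measurable_funM.
  by split => //; exact: measurable_funM.
- by split; exact: measurable_funD.
- by split; exact: measurable_funM.
Qed.

Lemma integ_trig (dX : measure_display) (X : measurableType dX) (M : probability X R)
    (Y : X -> I -> R) p : (forall i, measurable_fun setT (fun z => Y z i)) ->
  trig p -> integ M (fun z => jv (p (Y z))) /\ integ M (fun z => jl (p (Y z))).
Proof.
move=> mY tp; have [m1 m2] := measurable_trig mY tp; have [B HB] := trig_bounded tp.
by split; apply: (@integ_bounded _ _ _ _ _ B) => // z; have [] := HB (Y z).
Qed.

(** Integrating over the second space and then over the first applies
    [gaussian_cos] twice, with the first vector in the phase. *)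
Lemma expect_interp_cos (a : I -> R) (c t : R) : 0 <= t <= 1 ->
  \int[PQ]_z cos (\sum_i a i * interp t z i + c) =
  cos (c + \sum_i a i * vmean W i) *
  expR (- ((t * (\sum_i \sum_j vcov W i j * (a i * a j)) +
            (1 - t) * (\sum_i \sum_j vcov Z i j * (a i * a j))) / 2)).
Proof.
move=> /andP[t0 t1]; set k := c + _.
set qW := \sum_i \sum_j vcov W i j * _; set qZ := \sum_i \sum_j vcov Z i j * _.
pose u := Num.sqrt t; pose v := Num.sqrt (1 - t).
have uu : u * u = t by rewrite -expr2 sqr_sqrtr.
have vv : v * v = 1 - t by rewrite -expr2 sqr_sqrtr// subr_ge0.
have argE z : \sum_i a i * interp t z i + c =
    k + \sum_i (u * a i) * (W i z.1 - vmean W i) + \sum_i (v * a i) * (Z i z.2 - vmean Z i).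
  have -> : \sum_i a i * interp t z i = \sum_i a i * vmean W i +
      \sum_i (u * a i) * (W i z.1 - vmean W i) + \sum_i (v * a i) * (Z i z.2 - vmean Z i).
    by rewrite -!big_split /=; apply: eq_bigr => i _; rewrite /interp -/u -/v; ring.
  by rewrite /k; ring.
have mcos : measurable_fun setT (@cos R).
  by apply: continuous_measurable_fun; exact: continuous_cos.
have ip : integ PQ (fun z => cos (\sum_i a i * interp t z i + c)).
  have [//] := integ_trig PQ (measurable_interp t) (trig_cos cov_gap a c).
have qE (C : I -> I -> R) (s : R) :
   \sum_i \sum_j C i j * ((s * a i) * (s * a j)) = s * s * \sum_i \sum_j C i j * (a i * a j).
  rewrite mulr_sumr; apply: eq_bigr => i _; rewrite mulr_sumr.
  by apply: eq_bigr => j _; ring.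
rewrite expect_prod//; last first.
  move=> w; apply: (@integ_bounded _ _ _ _ _ 1) => [|u']; last exact: cos_max.
  apply: measurableT_comp => //; apply: measurable_funD => //.
  apply: measurable_sum => i; apply: measurable_funM => //.
  by apply: (measurableT_comp (measurable_interp t i)).
pose eZ := expR (- ((1 - t) * qZ / 2)).
have -> : \int[P]_w \int[Q]_u' cos (\sum_i a i * interp t (w, u') i + c) =
    \int[P]_w (eZ * cos (k + \sum_i (u * a i) * (W i w - vmean W i))).
  apply: eq_Rintegral => w _.
  rewrite mulrC /eZ -vv /qZ -qE -gaussian_cos//.
  by apply: eq_Rintegral => u' _; rewrite argE.
rewrite expectZ; last first.
  apply: (@integ_bounded _ _ _ _ _ 1) => [|w]; last exact: cos_max.
  apply: measurableT_comp => //; apply: measurable_funD => //.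
  apply: measurable_sum => i; apply: measurable_funM => //.
  exact: measurable_funB.
rewrite gaussian_cos// qE -/qW uu /eZ mulrCA -expRD; congr (_ * expR _).
by field.
Qed.

Lemma bil_cov_gap (a : I -> R) : bil cov_gap a a =
  (\sum_i \sum_j vcov W i j * (a i * a j) - \sum_i \sum_j vcov Z i j * (a i * a j)) / 2.
Proof.
rewrite /bil mulrC; congr (_ / _); rewrite -sumrB; apply: eq_bigr => i _.
by rewrite -sumrB; apply: eq_bigr => j _; rewrite /cov_gap mulrBl.
Qed.

(** For cos(a.x + c) the expectation is a constant times an exponential of an
    affine function of t with slope - bil a a, and - bil a a cos(a.x + c) is
    precisely the generator applied to it. The rest is linearity. *)
Lemma trig_interp_derive p : trig p -> exists psi psi' : R -> R,
  (forall t, is_derive t (1 : R) psi (psi' t)) /\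
  (forall t, 0 <= t <= 1 -> \int[PQ]_z jv (p (interp t z)) = psi t /\
                            \int[PQ]_z jl (p (interp t z)) = psi' t).
Proof.
elim=> [a c|{}p q tp [f [f' [df hf]]] tq [g [g' [dg hg]]]|k {}p tp [f [f' [df hf]]]].
- pose k := cos (c + \sum_i a i * vmean W i).
  pose qW := \sum_i \sum_j vcov W i j * (a i * a j).
  pose qZ := \sum_i \sum_j vcov Z i j * (a i * a j).
  pose ar (t : R) : R := - ((t * qW + (1 - t) * qZ) / 2).
  exists (fun t => k * expR (ar t)), (fun t => - bil cov_gap a a * (k * expR (ar t))).
  split=> [t|t t01].
    have dar : is_derive t (1 : R) ar (- (qW - qZ) / 2).
      have h := der_add (der_mul (is_derive_id t (1 : R)) (is_derive_cst (- (qW - qZ) / 2) t (1 : R)))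
        (is_derive_cst (- qZ / 2) t (1 : R)).
      by apply: (der_ext h) => [y|] /=; rewrite /cst /ar; field.
    have h := der_mul (is_derive_cst k t (1 : R)) (is_derive1_comp (@is_derive_expR R _) dar).
    by apply: (der_ext h) => [//|] /=; rewrite bil_cov_gap -/qW -/qZ; field.
  have H := expect_interp_cos a c t01.
  have [i1 _] := integ_trig PQ (measurable_interp t) (trig_cos cov_gap a c).
  by split; [exact: H|rewrite /= expectZ// H].
- exists (fun t => f t + g t), (fun t => f' t + g' t); split => [t|t t01].
    exact: der_add.
  have [f1 f2] := hf t t01; have [g1 g2] := hg t t01.
  have [i1 i2] := integ_trig PQ (measurable_interp t) tp.
  have [i3 i4] := integ_trig PQ (measurable_interp t) tq.
  by rewrite /= !expectD// f1 f2 g1 g2.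
- exists (fun t => k * f t), (fun t => k * f' t); split => [t|t t01].
    have h := der_mul (is_derive_cst k t (1 : R)) (df t).
    by apply: (der_ext h) => [//|] /=; rewrite /cst; ring.
  have [f1 f2] := hf t t01.
  have [i1 i2] := integ_trig PQ (measurable_interp t) tp.
  by rewrite /= !expectZ// f1 f2.
Qed.

(** A bound for the expectation of the l1 norm of [interp t], uniform in
    t in [0, 1]. *)
Definition spread : R := \sum_i (`|vmean W i| + \int[P]_w `|W i w - vmean W i|
                                 + \int[Q]_u `|Z i u - vmean Z i|).

(** Mean value theorem in t. The growth allowed in the hypothesis is linear
    because truncation perturbs the generator by such a term. *)
Lemma trig_interpolation p (K k : R) : trig p -> 0 <= k ->
  (forall x, `|jl (p x)| <= K + k * \sum_i `|x i|) ->
  `|\int[P]_w jv (p (fun i => W i w)) - \int[Q]_u jv (p (fun i => Z i u))|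
  <= K + k * spread.
Proof.
move=> tp k0 bnd.
have [psi [psi' [dpsi hpsi]]] := trig_interp_derive tp.
have E1 : \int[P]_w jv (p (fun i => W i w)) = psi 1.
  have [<- _] := hpsi 1 (introT andP (conj ler01 (lexx 1))).
  rewrite -(expect_fst Q); last first.
    by have [] := integ_trig P (fun i => measurable_funP (W i)) tp.
  apply: eq_Rintegral => z _; congr (jv (p _)); apply/funext => i.
  by rewrite /interp subrr sqrtr0 sqrtr1; ring.
have E0 : \int[Q]_u jv (p (fun i => Z i u)) = psi 0.
  have [<- _] := hpsi 0 (introT andP (conj (lexx 0) ler01)).
  rewrite -(expect_snd P); last first.
    by have [] := integ_trig Q (fun i => measurable_funP (Z i)) tp.
  apply: eq_Rintegral => z _; congr (jv (p _)); apply/funext => i.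
  by rewrite /interp subr0 sqrtr0 sqrtr1 eq_mean; ring.
rewrite E1 E0.
have [|c cI ->] := @MVT R psi psi' 0 1 ltr01 (fun x _ => dpsi x).
  by apply: derivable_within_continuous => x _; have := dpsi x => ?; exact: ex_derive.
have c01 : 0 <= c <= 1 by move: cI; rewrite in_itv /= => /andP[/ltW -> /ltW ->].
rewrite subr0 mulr1.
have [_ <-] := hpsi c c01.
have [_ il] := integ_trig PQ (measurable_interp c) tp.
apply: (le_trans (expect_norm_le il)).
pose V (z : T * U) : R := \sum_i (`|vmean W i| + `|W i z.1 - vmean W i| + `|Z i z.2 - vmean Z i|).
have iW i : integ PQ (fun z => `|W i z.1 - vmean W i|).
  by apply: (@integ_fst _ _ _ _ _ P Q (fun w => `|W i w - vmean W i|)); apply: integ_norm; exact: gaussian_integ_centered.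
have iZ i : integ PQ (fun z => `|Z i z.2 - vmean Z i|).
  by apply: (@integ_snd _ _ _ _ _ P Q (fun w => `|Z i w - vmean Z i|)); apply: integ_norm; exact: gaussian_integ_centered.
have im i : integ PQ (fun=> `|vmean W i|) by exact: integ_cst.
have iWm i := integD (im i) (iW i).
have iV : integ PQ V by apply: integ_sum => i; exact: integD (iWm i) (iZ i).
apply: (@le_trans _ _ (\int[PQ]_z (K + k * V z))).
  apply: expect_le; [exact: integ_norm| |move=> z].
    by apply: integD; [exact: integ_cst|exact: integZ].
  apply: (le_trans (bnd _)); rewrite lerD2l ler_wpM2l//; apply: ler_sum => i _.
  have sle (t : R) : 0 <= t <= 1 -> 0 <= Num.sqrt t <= 1.
    by move=> /andP[t0 t1]; rewrite sqrtr_ge0 /= -sqrtr1 ler_sqrt.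
  have mul_le (s y : R) : 0 <= s <= 1 -> `|s * y| <= `|y|.
    by move=> /andP[s0 s1]; rewrite normrM ger0_norm// ler_piMl.
  rewrite /interp (le_trans (ler_normD _ _))// lerD//; last first.
    apply: mul_le; apply: sle; move: c01 => /andP[c0 c1].
    by rewrite subr_ge0 c1 /= lerBlDr lerDl.
  by rewrite (le_trans (ler_normD _ _))// lerD2l; apply: mul_le; exact: sle.
rewrite (expectD (integ_cst _ K) (integZ k iV)) expect_cst expectZ// lerD2l.
rewrite ler_wpM2l//.
rewrite expect_sum => [|i]; last exact: integD (iWm i) (iZ i).
apply: ler_sum => i _; rewrite (expectD (iWm i) (iZ i)) (expectD (im i) (iW i)) expect_cst.
rewrite (@expect_fst _ _ _ _ _ P Q (fun w => `|W i w - vmean W i|)); last first.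
  by apply: integ_norm; exact: gaussian_integ_centered.
rewrite (@expect_snd _ _ _ _ _ P Q (fun w => `|Z i w - vmean Z i|))//.
by apply: integ_norm; exact: gaussian_integ_centered.
Qed.

End interpolation.

(** * Comparison of order statistics *)

Section optimisation.
Context {R : realType}.

Lemma le_limit_eta (x y C : R) : 0 <= C ->
  (forall e, 0 < e <= 1 -> x <= y + C * e) -> x <= y.
Proof.
move=> C0 H; apply/ler_addgt0Pr => e e0.
pose e' := Num.min 1 (e / (C + 1)).
have C1 : 0 < C + 1 by rewrite ltr_wpDl.
have e'0 : 0 < e' by rewrite lt_min ltr01 divr_gt0.
apply: (le_trans (H e' _)); first by rewrite e'0 ge_min lexx.
rewrite lerD2l; apply: (@le_trans _ _ (C * (e / (C + 1)))).
  by rewrite ler_wpM2l// ge_min lexx orbT.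
by rewrite mulrCA ler_piMr ?(ltW e0)// ler_pdivrMr// mul1r lerDl.
Qed.

(** The minimisers are b = 2 sqrt(H/g) and a = sqrt(2M/g). All three square
    roots are shifted by e > 0 so that a and b exist when g, H or M vanishes;
    the shift is then sent to 0. *)
Lemma optimise_temperatures (D g M H : R) : 0 <= g -> 0 <= M -> 0 <= H ->
  (forall a b, 0 < a -> 0 < b -> D <= g * (b / 4 + a / 2) + M / a + H / b) ->
  D <= Num.sqrt g * (Num.sqrt (2 * M) + Num.sqrt H).
Proof.
move=> g0 M0 H0 bnd.
set sg := Num.sqrt g; set sM := Num.sqrt (2 * M); set sH := Num.sqrt H.
have M20 : 0 <= 2 * M by rewrite mulr_ge0.
have [sg0 sM0 sH0] : [/\ 0 <= sg, 0 <= sM & 0 <= sH] by rewrite !sqrtr_ge0.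
have gE : sg ^+ 2 = g by rewrite sqr_sqrtr.
have ME : sM ^+ 2 = 2 * M by rewrite sqr_sqrtr.
have HE : sH ^+ 2 = H by rewrite sqr_sqrtr.
apply: (@le_limit_eta _ _ (2 * sg + sM + sH + 2)); first by rewrite !addr_ge0 ?mulr_ge0.
move=> e /andP[e0 e1].
pose u := sg + e; pose v := sH + e; pose w := sM + e.
have [u0 v0 w0] : [/\ 0 < u, 0 < v & 0 < w] by rewrite !ltr_wpDl.
apply: (@le_trans _ _ (u * (v + w))); last first.
  have ee : e * e <= e by rewrite ler_piMr// ltW.
  rewrite /u /v /w; nra.
have b0 : 0 < 2 * (v / u) by rewrite mulr_gt0// divr_gt0.
have a0 : 0 < w / u by rewrite divr_gt0.
apply: (le_trans (bnd _ _ a0 b0)).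
have un : u != 0 by rewrite gt_eqF.
have vn : v != 0 by rewrite gt_eqF.
have wn : w != 0 by rewrite gt_eqF.
have gu : g <= u ^+ 2 by rewrite -gE lerXn2r ?nnegrE ?(ltW u0)// /u lerDl ltW.
have Hv : H <= v ^+ 2 by rewrite -HE lerXn2r ?nnegrE ?(ltW v0)// /v lerDl ltW.
have Mw : 2 * M <= w ^+ 2 by rewrite -ME lerXn2r ?nnegrE ?(ltW w0)// /w lerDl ltW.
have -> : g * (2 * (v / u) / 4 + w / u / 2) + M / (w / u) + H / (2 * (v / u)) =
   (g / u) * (v + w) / 2 + (2 * M / w) * u / 2 + (H / v) * u / 2.
  by field; rewrite un vn wn.
have g1 : g / u <= u by rewrite ler_pdivrMr// -expr2.
have H1 : H / v <= v by rewrite ler_pdivrMr// -expr2.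
have M1 : 2 * M / w <= w by rewrite ler_pdivrMr// -expr2.
have vw : 0 < v + w by rewrite addr_gt0.
have := ler_wpM2r (ltW vw) g1; have := ler_wpM2r (ltW u0) H1; have := ler_wpM2r (ltW u0) M1.
lra.
Qed.

(** C(d,h) h! <= d^h, and h^h / h! is a term of the series of exp h. *)
Lemma ln_bin_le (d h : nat) : (1 <= h)%N -> (h <= d)%N ->
  ln 'C(d, h)%:R <= h%:R * (1 + ln (d%:R / h%:R)) :> R.
Proof.
move=> h1 hd.
have h0 : 0 < h%:R :> R by rewrite ltr0n.
have d0 : 0 < d%:R :> R by rewrite ltr0n (leq_trans h1).
have f0 : 0 < h`!%:R :> R by rewrite ltr0n fact_gt0.
have C0 : 0 < 'C(d, h)%:R :> R by rewrite ltr0n bin_gt0.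
have Cle : 'C(d, h)%:R * h`!%:R <= d%:R ^+ h :> R.
  rewrite -natrM bin_ffact -natrX ler_nat.
  elim: h {h1 h0 f0 C0} hd => // n IH nd; rewrite ffactnSr expnSr.
  by rewrite leq_mul ?leq_subr// IH// ltnW.
have hf : h%:R ^+ h / h`!%:R <= expR h%:R :> R.
  have h00 := ltW h0.
  have inc m k : (m <= k)%N ->
      series (exp_coeff (h%:R : R)) m <= series (exp_coeff (h%:R : R)) k.
    move=> mk; rewrite -subr_ge0 sub_series_geq// sumr_ge0// => i _.
    exact: exp_coeff_ge0.
  apply: (@le_trans _ _ (series (exp_coeff (h%:R : R)) h.+1)); last first.
    by apply: nondecreasing_cvgn_le => //; exact: is_cvg_series_exp_coeff.
  rewrite /series /= big_nat_recr//= /exp_coeff lerDr sumr_ge0// => i _.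
  exact: exp_coeff_ge0.
have -> : h%:R * (1 + ln (d%:R / h%:R)) = ln (expR h%:R * (d%:R / h%:R) ^+ h) :> R.
  rewrite lnM ?posrE ?expR_gt0 ?exprn_gt0 ?divr_gt0// expRK lnXn ?divr_gt0//.
  by rewrite mulrDr mulr1 mulr_natl.
rewrite ler_ln ?posrE ?mulr_gt0 ?expR_gt0 ?exprn_gt0 ?divr_gt0//.
apply: (@le_trans _ _ (h%:R ^+ h / h`!%:R * (d%:R / h%:R) ^+ h)); last first.
  by rewrite ler_wpM2r// exprn_ge0// divr_ge0.
rewrite exprMn exprVn mulrAC mulrCA mulfV ?mulr1; last by rewrite expf_neq0// gt_eqF.
by rewrite ler_pdivlMr.
Qed.

End optimisation.

Section comparison.
Context {R : realType} (dT : measure_display) (T : measurableType dT)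
  (dU : measure_display) (U : measurableType dU).
Variables (P : probability T R) (Q : probability U R) (d : nat).
Variables (W : 'I_d -> {RV P >-> R}) (Z : 'I_d -> {RV Q >-> R}).
Hypotheses (gaussW : gaussian_vector W) (gaussZ : gaussian_vector Z).
Hypothesis eq_mean : forall i, vmean W i = vmean Z i.
Variable g : R.
Hypothesis incr_le : forall i j,
  `|\int[P]_w ((W i w - W j w) ^+ 2) - \int[Q]_u ((Z i u - Z j u) ^+ 2)| <= g.
Variable h : nat.
Hypotheses (h_gt0 : (1 <= h)%N) (h_le_d : (h <= d)%N).

Lemma integ_order_stat (dX : measure_display) (X : measurableType dX)
    (M : probability X R) (Y : 'I_d -> {RV M >-> R}) : gaussian_vector Y ->
  integ M (fun w => order_stat (fun i => Y i w) h).
Proof.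
move=> gY; apply: (@integ_le _ _ _ _ _ (fun w => \sum_i `|Y i w|)) => [|w|].
- by apply: measurable_order_stat => // i; exact: measurable_funP.
- exact: order_stat_norm_le.
- by apply: integ_sum => i; apply: integ_norm; exact: gaussian_integ.
Qed.

(** An order statistic is 1-Lipschitz for the sup norm, and
    |L sin(y/L) - y| <= y^2 / L. *)
Lemma order_stat_sine (L : R) (x : 'I_d -> R) : 0 < L ->
  `|order_stat (fun i => L * sin (x i / L)) h - order_stat x h| <=
  (\sum_i x i ^+ 2) / L.
Proof.
move=> L0; have Ln0 : L != 0 by rewrite gt_eqF.
have near_i i : `|L * sin (x i / L) - x i| <= (\sum_i x i ^+ 2) / L.
  have -> : L * sin (x i / L) - x i = L * (sin (x i / L) - x i / L) by field.
  rewrite normrM gtr0_norm//; apply: (@le_trans _ _ (L * (x i / L) ^+ 2)).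
    by rewrite ler_pM2l// sin_near_id.
  have -> : L * (x i / L) ^+ 2 = x i ^+ 2 / L by field.
  rewrite ler_pM2r ?invr_gt0// (bigD1 i)//= lerDl sumr_ge0// => j _.
  exact: sqr_ge0.
set e := _ / L in near_i *.
rewrite ler_norml; apply/andP; split.
  rewrite lerBrDl -lerBrDr opprK; apply: order_stat_leD => // i.
  have := near_i i; rewrite ler_norml => /andP[]; lra.
rewrite lerBlDl; apply: order_stat_leD => // i.
have := near_i i; rewrite ler_norml => /andP[]; lra.
Qed.

(** The truncation length is 1/e and the approximation error e; both errors are
    at most a constant independent of e, times e. *)
Lemma order_stat_gap_temperatures (a b : R) : 0 < a -> 0 < b ->
  `|\int[P]_w order_stat (fun i => W i w) h - \int[Q]_u order_stat (fun i => Z i u) h|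
  <= g * (b / 4 + a / 2) + ln 'C(d, h)%:R / a + ln h%:R / b.
Proof.
move=> a0 b0; pose A := cov_gap W Z.
have Asym i j : A i j = A j i by rewrite /A /cov_gap !(vcovC _ i).
have A_incr i j : `|A i i + A j j - 2 * A i j| <= g.
  have := incr_le i j; rewrite !expect_incr_sqr// !eq_mean; congr (`|_| <= _).
  by rewrite /A /cov_gap; ring.
pose N := \sum_i \sum_j `|A i j|.
have N0 : 0 <= N by do 2 apply: sumr_ge0 => ? _.
pose s2 (dX : measure_display) (X : measurableType dX)
    (M : probability X R) (Y : 'I_d -> {RV M >-> R}) : R :=
  \int[M]_w \sum_i Y i w ^+ 2.
have i2 (dX : measure_display) (X : measurableType dX)
    (M : probability X R) (Y : 'I_d -> {RV M >-> R}) : gaussian_vector Y ->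
    integ M (fun w => \sum_i Y i w ^+ 2).
  by move=> gY; apply: integ_sum => i; exact: gaussian_integ_sqr.
have s2_ge0 (dX : measure_display) (X : measurableType dX)
    (M : probability X R) (Y : 'I_d -> {RV M >-> R}) : 0 <= s2 _ _ _ Y.
  by apply: Rintegral_ge0 => w _; apply: sumr_ge0 => i _; exact: sqr_ge0.
have sp0 : 0 <= spread W Z.
  by apply: sumr_ge0 => i _; rewrite !addr_ge0//; apply: Rintegral_ge0 => w _.
pose k0 := 8 * N * (b / 4 + a / 2).
have k00 : 0 <= k0 by rewrite !mulr_ge0// addr_ge0// divr_ge0// ltW.
pose C := 3 + N + k0 * spread W Z + s2 _ _ _ W + s2 _ _ _ Z.
apply: (@le_limit_eta _ _ _ C); first by rewrite !addr_ge0// mulr_ge0.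
move=> e /andP[e0 _].
pose L := e^-1; have L0 : 0 < L by rewrite invr_gt0.
have [F aF HF] := soft_jet Asym A_incr L0 h_gt0 h_le_d a0 b0.
have [p tp Hp] := aF e e0.
have bnd x : `|jl (p x)| <= (e + g * (b / 4 + a / 2) + N * e) + (k0 * e) * \sum_i `|x i|.
  have [_ HFl] := HF x; have [_ _ Hl] := Hp x.
  have -> : jl (p x) = jl (jsub (p x) (F x)) + jl (F x) by rewrite /=; ring.
  apply: (le_trans (ler_normD _ _)); apply: (le_trans (lerD Hl HFl)).
  by rewrite -/N /L invrK le_eqVlt; apply/orP; left; apply/eqP; rewrite /k0; ring.
have := trig_interpolation gaussW gaussZ eq_mean tp (mulr_ge0 k00 (ltW e0)) bnd.
(* Only these pointwise bounds on p are integrated, so no expectation of the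
   smoothed statistic occurs. *)
have sandwich x :
    - (ln 'C(d, h)%:R / a + (\sum_i x i ^+ 2) * e + e) <= jv (p x) - order_stat x h <=
    ln h%:R / b + (\sum_i x i ^+ 2) * e + e.
  have [HFv _] := HF x; have [Hv _ _] := Hp x.
  have := order_stat_sine x L0.
  have -> : (\sum_i x i ^+ 2) / L = (\sum_i x i ^+ 2) * e by rewrite /L invrK.
  rewrite ler_norml => /andP[h1 h2].
  have h3 := soft_order_stat_ge h_gt0 h_le_d (fun i => L * sin (x i / L)) a0 b0.
  have h4 := soft_order_stat_le h_gt0 h_le_d (fun i => L * sin (x i / L)) a0 b0.
  rewrite -HFv in h3 h4; move: Hv; rewrite /= mulN1r ler_norml => /andP[h5 h6].
  by apply/andP; split; lra.
have gap (dX : measure_display) (X : measurableType dX)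
    (M : probability X R) (Y : 'I_d -> {RV M >-> R}) : gaussian_vector Y ->
    - (ln 'C(d, h)%:R / a + s2 _ _ _ Y * e + e) <=
    \int[M]_w jv (p (fun i => Y i w)) - \int[M]_w order_stat (fun i => Y i w) h <=
    ln h%:R / b + s2 _ _ _ Y * e + e.
  move=> gY; have [ip _] := integ_trig M (fun i => measurable_funP (Y i)) tp.
  have io := integ_order_stat gY; have is2 := i2 _ _ _ _ gY.
  rewrite -expectB//.
  have ce (c : R) : \int[M]_w (c + e * \sum_i Y i w ^+ 2) = c + s2 _ _ _ Y * e.
    by rewrite (expectD (integ_cst M c) (integZ e is2)) expect_cst expectZ// mulrC.
  have ce' (c : R) : \int[M]_w (c + - e * \sum_i Y i w ^+ 2) = c - s2 _ _ _ Y * e.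
    by rewrite (expectD (integ_cst M c) (integZ (- e) is2)) expect_cst expectZ// mulNr mulrC.
  have -> : - (ln 'C(d, h)%:R / a + s2 _ _ _ Y * e + e) =
    - (ln 'C(d, h)%:R / a + e) - s2 _ _ _ Y * e by ring.
  have -> : ln h%:R / b + s2 _ _ _ Y * e + e =
    (ln h%:R / b + e) + s2 _ _ _ Y * e by ring.
  rewrite -ce -ce'; apply/andP; split; apply: expect_le.
  - by apply: integD; [exact: integ_cst|exact: integZ].
  - exact: integB.
  - by move=> w; have /andP[+ _] := sandwich (fun i => Y i w); lra.
  - exact: integB.
  - by apply: integD; [exact: integ_cst|exact: integZ].
  - by move=> w; have /andP[_ +] := sandwich (fun i => Y i w); lra.
have /andP[w1 w2] := gap _ _ _ _ gaussW; have /andP[z1 z2] := gap _ _ _ _ gaussZ.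
rewrite !ler_norml /C => /andP[t1 t2].
by apply/andP; split; lra.
Qed.

End comparison.

Theorem corollary1 (R : realType)
    (dT : measure_display) (T : measurableType dT) (P : probability T R)
    (dU : measure_display) (U : measurableType dU) (Q : probability U R)
    (d : nat) (W : 'I_d -> {RV P >-> R}) (Z : 'I_d -> {RV Q >-> R})
    (gaussW : gaussian_vector W) (gaussZ : gaussian_vector Z)
    (eq_mean : forall i : 'I_d, ('E_P[W i] = 'E_Q[Z i])%E)
    (h : nat) (h_gt0 : (1 <= h)%N) (h_le_d : (h <= d)%N) :
  let gamma : R := increment_gap W Z in
  (`| 'E_P[fun w => order_stat (fun i => W i w) h]
      - 'E_Q[fun u => order_stat (fun i => Z i u) h] |
    <= (Num.sqrt gamma * (Num.sqrt (2 * ln ('C(d, h)%:R : R))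
                          + Num.sqrt (ln (h%:R : R))))%R%:E)%E
  /\ Num.sqrt gamma * (Num.sqrt (2 * ln ('C(d, h)%:R : R))
                       + Num.sqrt (ln (h%:R : R)))
     <= Num.sqrt gamma * (Num.sqrt (2 * h%:R * (1 + ln (d%:R / h%:R : R)))
                          + Num.sqrt (ln (h%:R : R))).
Proof.
move=> gamma; split; last first.
  rewrite ler_wpM2l ?sqrtr_ge0// lerD2r ler_wsqrtr// -mulrA ler_pM2l//.
  exact: ln_bin_le.
have Eint (dX : measure_display) (X : measurableType dX) (M : probability X R)
    (f : X -> R) : integ M f -> 'E_M[f]%E = (\int[M]_w f w)%:E.
  by move=> hf; rewrite unlock /Rintegral fineK//; exact: integrable_fin_num.
have mean_eq i : vmean W i = vmean Z i.
  have := eq_mean i; rewrite !Eint; [by case| |]; exact: gaussian_integ.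
have incr_le i j :
    `|\int[P]_w ((W i w - W j w) ^+ 2) - \int[Q]_u ((Z i u - Z j u) ^+ 2)| <= gamma.
  rewrite /gamma /increment_gap.
  have := le_bigmax 0 (fun ij : 'I_d * 'I_d =>
    `|fine 'E_P[fun w => ((W ij.1 w - W ij.2 w) ^+ 2)%R]
      - fine 'E_Q[fun u => ((Z ij.1 u - Z ij.2 u) ^+ 2)%R]|) (i, j).
  by rewrite /= unlock.
have gamma_ge0 : 0 <= gamma.
  by apply: le_trans (incr_le (Ordinal (leq_trans h_gt0 h_le_d)) (Ordinal (leq_trans h_gt0 h_le_d))).
rewrite !Eint; [|exact: integ_order_stat..].
rewrite -EFinB abse_EFin lee_fin.
apply: optimise_temperatures => //.
- by rewrite ln_ge0// ler1n bin_gt0.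
- by rewrite ln_ge0// ler1n.
- by move=> a b a0 b0; exact: order_stat_gap_temperatures.
Qed.
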